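(* In the discrete ergodic setting described in the context, let $\xi=(\xi_1,\dots,\xi_d)$ be a random vector on $X$ such that for some constant $c\ge1$ and $\mu$-almost all $\eta\in X$, $1/c\le\xi_i(\eta)\le c$ for $i=1,\dots,d$. Let $\sigma(\xi,\mu)$ be the symmetric $d\times d$ matrix given by $${}^tl\,\sigma(\xi,\mu)\,l=\inf_{f\in L^2(\mu)}\sum_{i=1}^d\big\langle\xi_i(l_i+D_if)^2\big\rangle,\qquad l\in\mathbb{R}^d,$$ and for $N\in\{1,2,\dots\}$, $\eta\in X$, let $\sigma(\xi^N,\eta)$ be the symmetric $d\times d$ matrix given by $${}^tl\,\sigma(\xi^N,\eta)\,l=\inf_{f:T^d_N\to\mathbb{R}}N^{-d}\sum_{x\in T^d_N}\sum_{i=1}^d\xi^N_i(x,\eta)\big(l_i+f(x+e_i)-f(x)\big)^2,\qquad l\in\mathbb{R}^d,$$ where $\xi^N(x,\eta)=\xi(\tau_{-y}\eta)$ for $x=y+Nz$, $y\in\{0,\dots,N-1\}^d$, $z\in\mathbb{Z}^d$. Then for $\mu$-almost all $\eta\in X$, $$\lim_{N\to+\infty}\sigma(\xi^N,\eta)=\sigma(\xi,\mu).$$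
   Context: $d\ge1$. $(X,\mathcal{G},\mu)$ is a probability space, $\langle f\rangle=\int_Xf\,d\mu$. A group $\{\tau_x:x\in\mathbb{Z}^d\}$ ($\tau_{x+y}=\tau_x\tau_y$) of measurable transformations acts on $X$ with $\mu(\tau_xB)=\mu(B)$ for all $x\in\mathbb{Z}^d$, $B\in\mathcal{G}$, and ergodically: if $B\in\mathcal{G}$ satisfies $\tau_xB=B$ for all $x\in\mathbb{Z}^d$ then $\mu(B)\in\{0,1\}$. For $f:X\to\mathbb{R}$, $D_if(\eta)=f(\tau_{-e_i}\eta)-f(\eta)$. $T^d_N=\mathbb{Z}^d/(N\mathbb{Z}^d)$. ($\xi_i(x,\eta)=\xi_i(\tau_{-x}\eta)$ is the jump rate across the bond $\{x,x+e_i\}$ of a symmetric nearest neighbor random walk on $\mathbb{Z}^d$, and $\xi^N$ is its periodization.) *)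

(* Defs.v *)
From HB Require Import structures.
From mathcomp Require Import all_boot all_order all_algebra.
From mathcomp Require Import all_classical all_reals all_analysis.
Import Order.TTheory GRing.Theory Num.Theory.
Import numFieldNormedType.Exports.

Set Implicit Arguments.
Unset Strict Implicit.
Unset Printing Implicit Defensive.

Local Open Scope classical_set_scope.
Local Open Scope ring_scope.

(* Z^d is 'rV[int]_d, with canonical basis e_i. *)
Definition unitZ (d : nat) (i : 'I_d) : 'rV[int]_d := delta_mx 0 i.

(* T^d_N = Z^d/(N Z^d) for N > 0: N.-1.+1 is N, in the form on which 'I_ has
   its group structure (addition modulo N); N = 0 is a junk case. *)
Definition torus (d N : nat) := 'rV['I_N.-1.+1]_d.

(* The class of e_i; for N = 1 it is 0. *)
Definition unitT (d N : nat) (i : 'I_d) : torus d N :=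
  \row_(j < d) inZp (i == j).

Definition torus_repr (d N : nat) (x : torus d N) : 'rV[int]_d :=
  map_mx (fun k : 'I_N.-1.+1 => (k : nat)%:Z) x.

Record ergodic_action (disp : measure_display) (T : measurableType disp)
    (R : realType) (mu : probability T R) (d : nat)
    (tau : 'rV[int]_d -> T -> T) : Prop := ErgodicAction {
  action0 : forall eta, tau 0 eta = eta ;
  actionD : forall x y eta, tau (x + y) eta = tau x (tau y eta) ;
  action_measurable : forall x, measurable_fun setT (tau x) ;
  action_preserving : forall x (B : set T), measurable B ->
    mu (tau x @` B) = mu B ;
  action_ergodic : forall B : set T, measurable B ->
    (forall x, tau x @` B = B) -> mu B = 0%E \/ mu B = 1%E }.

Definition is_form_matrix (R : realType) (d : nat)
    (Q : 'cV[R]_d -> \bar R) (S : 'M[R]_d) : Prop :=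
  S^T = S /\ forall l : 'cV[R]_d, ((l^T *m S *m l) 0 0)%:E = Q l.

Lemma is_form_matrix_unique (R : realType) (d : nat) (Q : 'cV[R]_d -> \bar R)
  (S S' : 'M[R]_d) : is_form_matrix Q S -> is_form_matrix Q S' -> S = S'.
Proof.
move=> [sS QS] [sS' QS'].
have q (l : 'cV[R]_d) : (l^T *m S *m l) 0 0 = (l^T *m S' *m l) 0 0.
  by have := QS l; rewrite -QS' => -[].
have E (M : 'M[R]_d) i j :
    ((delta_mx i 0 : 'cV[R]_d)^T *m M *m (delta_mx j 0 : 'cV[R]_d)) 0 0 = M i j.
  by rewrite trmx_delta -rowE -colE !mxE.
have pol (M : 'M[R]_d) i j : M^T = M ->
    let v : 'cV[R]_d := delta_mx i 0 + delta_mx j 0 in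
    (v^T *m M *m v) 0 0 = M i i + M j j + M i j *+ 2.
  move=> sM /=; rewrite [(_ + _)^T]linearD /= !mulmxDl !mulmxDr.
  have MD (A B : 'M[R]_1) : (A + B) 0 0 = A 0 0 + B 0 0 by rewrite mxE.
  have Mji : M j i = M i j by rewrite -[in LHS]sM mxE.
  by rewrite !MD !E Mji mulr2n [M i j + M j j]addrC addrACA.
have di i : S i i = S' i i by rewrite -E q E.
apply/matrixP => i j; have := q (delta_mx i 0 + delta_mx j 0).
by rewrite !pol// !di => /addrI /eqP; rewrite eqr_pMn2r// => /eqP.
Qed.

(* The symmetric matrix with quadratic form Q, unique when it exists. *)
Definition form_matrix (R : realType) (d : nat)
    (Q : 'cV[R]_d -> \bar R) : 'M[R]_d :=
  get [set S | is_form_matrix Q S].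

Section homogenization.
Context (disp : measure_display) (T : measurableType disp) (R : realType).
Context (mu : probability T R) (d : nat) (tau : 'rV[int]_d -> T -> T).

Definition gradD (f : T -> R) (i : 'I_d) (eta : T) : R :=
  f (tau (- unitZ i) eta) - f eta.

Context (xi : 'I_d -> T -> R).

Definition hom_form (l : 'cV[R]_d) : \bar R :=
  ereal_inf [set (\sum_(i < d)
      'E_mu[fun eta => (xi i eta * (l i 0 + gradD f i eta) ^+ 2)%R])%E
    | f in [set f : T -> R | f \in Lfun mu 2%:E]].

Definition hom_matrix : 'M[R]_d := form_matrix hom_form.

(* The representative y of x in {0, ..., N-1}^d is x mod N, coordinatewise. *)
Definition periodized (N : nat) (i : 'I_d) (x : 'rV[int]_d) (eta : T) : R :=
  xi i (tau (- map_mx (fun k : int => (k %% N)%Z) x) eta).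

Definition per_form (N : nat) (eta : T) (l : 'cV[R]_d) : \bar R :=
  ereal_inf [set ((N%:R ^- d) * \sum_(x : torus d N) \sum_(i < d)
      periodized N i (torus_repr x) eta *
        (l i 0 + f (x + unitT N i) - f x) ^+ 2)%:E
    | f in [set: torus d N -> R]].

Definition per_matrix (N : nat) (eta : T) : 'M[R]_d :=
  form_matrix (per_form N eta).

End homogenization.

(* Main.v *)
Require Import Defs.
From HB Require Import structures.
From mathcomp Require Import all_boot all_order all_algebra.
From mathcomp Require Import all_classical all_reals all_analysis.
From mathcomp Require Import measurable_realfun.
From mathcomp Require Import ring lra.
Import Order.TTheory GRing.Theory Num.Theory.
Import numFieldNormedType.Exports.

                                                                              
                                                                       

                                                                                
                                                                                 
                                                                           
                                                                            
                                  

                                                                             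
                                                                                 
                                                                                 
                                                                                  
                                                                              
                                                                   
                                                                              
                                

                                                                             
                                                                             
                                                                                 
                                                                           

(** Both infima are quadratic forms in l, so it is enough to compare them for each fixed l and to
    recover the matrix entries by polarization. The comparison is a two-sided bound up to an
    arbitrary e > 0, valid for almost every eta once N is large.

    Upper bound ([per_value_upper]). A near-optimal f on X can be taken bounded, by truncation. Its
    trace x -> f(tau_{-x} eta) on the box {0,...,N-1}^d is a test function on the torus. Off the
    faces x_i = N-1 its increments are those of f along the orbit, so up to O(1/N) its energy is a
    box average of a bounded function, whose limit is given by the multiparameter ergodic theorem
    ([ergodic_theorem]).

    Lower bound ([per_value_lower]). Completing the square gives xi (l + a)^2 >= 2 l q - q^2 / xi +
    2 q a, so each field q on the torus that is orthogonal to gradients bounds the periodic energy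
    from below ([per_energy_dual]). On X the right choice is q = xi k, with k the residual of the
    constant field l after projection onto gradients in L^2(xi mu) ([optimal_flux]). Copying xi k to
    the box would spoil orthogonality at the faces. It is therefore first approximated in L^2 by a
    constant plus the curl of a bounded potential ([curl_approx]). The potential is copied to the
    torus, and its discrete curl taken there is exactly orthogonal to gradients
    ([torus_flux_orthogonal]) while differing from the original only near the faces.

    The density statements [cohomologous_approx] and [curl_approx] both rest on Hilbert space
    projection: the residual is shown to be translation invariant, hence constant by ergodicity,
    hence zero. The ergodic theorem combines the first of them with Garsia's maximal inequality,
    iterated over the coordinate directions. *)

Set Implicit Arguments.
Unset Strict Implicit.
Unset Printing Implicit Defensive.

Local Open Scope classical_set_scope.
Local Open Scope ring_scope.

                                                                        

(** * Projection onto a subspace for a positive semidefinite form *)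

Section projection.
Context (R : realType) (X : Type).
Implicit Types f g h k w : X -> R.

(** This one operation carries all of linearity: closure of domains and subspaces and bilinearity of
    [B] are each a single hypothesis about it. With a = -1 it is the difference g - f. *)
Definition axpy (a : R) f g : X -> R := fun x => a * f x + g x.

Context (D : (X -> R) -> Prop) (B : (X -> R) -> (X -> R) -> R).
Hypothesis D_axpy : forall a f g, D f -> D g -> D (axpy a f g).
Hypothesis B_sym : forall f g, B f g = B g f.
Hypothesis B_axpy : forall a f g h, D f -> D g -> D h ->
  B (axpy a f g) h = a * B f h + B g h.
Hypothesis B_ge0 : forall f, D f -> 0 <= B f f.

Lemma form_axpyr a f g h : D f -> D g -> D h ->
  B h (axpy a f g) = a * B h f + B h g.
Proof. by move=> *; rewrite B_sym B_axpy// [B f _]B_sym [B g _]B_sym. Qed.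

Lemma form_sqr_axpy a f g : D f -> D g ->
  B (axpy a f g) (axpy a f g) = a ^+ 2 * B f f + 2 * a * B f g + B g g.
Proof.
move=> Df Dg; have Dfg := D_axpy a Df Dg.
by rewrite B_axpy// !form_axpyr// [B g f]B_sym; ring.
Qed.

(** The discriminant bound, read off at the minimizer t = - b / a. It yields Cauchy-Schwarz, and for
    small e it turns near-minimality into near-orthogonality. *)
Lemma sqr_le_of_quadratic_ge (a b e : R) : 0 <= e -> 0 <= a ->
  (forall t, - e <= t ^+ 2 * a + 2 * t * b) -> b ^+ 2 <= e * a.
Proof.
move=> e0 a0 H; have [a_eq0|ap] := eqVneq a 0.
  rewrite a_eq0 mulr0; have [->|b0] := eqVneq b 0; first by rewrite expr0n.
  (* When a = 0 a nonzero b is impossible: this t gives the value -2 (e + 1), which is below -e. *)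
  have := H (- (e + 1) / b); rewrite a_eq0 mulr0 add0r.
  have -> : 2 * (- (e + 1) / b) * b = - 2 * (e + 1) by field.
  by lra.
have a_gt0 : 0 < a by rewrite lt_def ap.
have := H (- b / a).
have -> : (- b / a) ^+ 2 * a + 2 * (- b / a) * b = - (b ^+ 2 / a) by field.
by rewrite lerN2 ler_pdivrMr// mulrC.
Qed.

Lemma form_cauchy_schwarz f g : D f -> D g -> B f g ^+ 2 <= B f f * B g g.
Proof.
move=> Df Dg; rewrite mulrC; apply: sqr_le_of_quadratic_ge; try exact: B_ge0.
move=> t; have := B_ge0 (D_axpy t Df Dg); rewrite form_sqr_axpy//; lra.
Qed.

Lemma le0_of_le_geometric (a : R) (C : R) : (forall n : nat, a <= C * 4 ^- n) -> a <= 0.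
Proof.
move=> H; apply/ler_addgt0Pl => e e0; rewrite addr0.
have : (fun n => C * (4^-1) ^+ n) @ \oo --> C * 0.
  by apply: cvgMr; apply: cvg_expr; rewrite ger0_norm; lra.
rewrite mulr0 => /cvgrPdist_le /(_ e e0) [n _ /(_ n (leqnn n))] /=.
rewrite sub0r normrN exprVn => /ler_normlW; exact: le_trans.
Qed.

Hypothesis B_complete : forall u : nat -> X -> R, (forall n, D (u n)) ->
  (forall n m, (n <= m)%N ->
     B (axpy (-1) (u m) (u n)) (axpy (-1) (u m) (u n)) <= 4 ^- n) ->
  exists C v, D v /\
    forall n, B (axpy (-1) v (u n)) (axpy (-1) v (u n)) <= C * 4 ^- n.

(** By the parallelogram law the residuals h - w_n of a minimizing sequence are Cauchy, and
    minimality makes their limit k orthogonal to W. The infimum need not be attained in W, so the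
    last clause only provides w with h - w close to k. Fixing the rate 4^-n from the start avoids
    extracting subsequences. *)
Theorem orthogonal_residual (W : (X -> R) -> Prop) h :
  W (fun=> 0) -> (forall f, W f -> D f) ->
  (forall a f g, W f -> W g -> W (axpy a f g)) -> D h ->
  exists k, [/\ D k, (forall w, W w -> B k w = 0) &
    forall e, 0 < e -> exists2 w, W w &
      let r := axpy (-1) k (axpy (-1) w h) in D r /\ B r r <= e].
Proof.
move=> W0 WD Waxpy Dh.
pose N f := B f f.
pose A := [set N (axpy (-1) w h) | w in W].
have Ainf : has_inf A.
  split; first by exists (N (axpy (-1) (fun=> 0) h)), (fun=> 0).
  by exists 0 => _ [w Ww <-]; apply: B_ge0; apply: D_axpy => //; apply: WD.
set d := inf A.
have dle w : W w -> d <= N (axpy (-1) w h).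
  by move=> Ww; apply: ge_inf; [exact: Ainf.2|exists w].
(* With this tolerance the parallelogram law bounds the squared distance of two residuals by
   4^-n. *)
have e_gt0 n : 0 < (4 ^- n / 4 : R) by rewrite divr_gt0// invr_gt0 exprn_gt0.
have /choice[w w_] : forall n : nat, exists w : X -> R,
    W w /\ N (axpy (-1) w h) <= d + 4 ^- n / 4.
  move=> n; have [_ [w Ww <-] lt] := @inf_adherent _ _ _ (e_gt0 n) Ainf.
  by exists w; split => //; exact: ltW.
have Ww n := (w_ n).1; pose u n := axpy (-1) (w n) h.
have Du n : D (u n) by apply: D_axpy => //; apply: WD.
have Nu n : N (u n) <= d + 4 ^- n / 4 := (w_ n).2.
have cau n m : (n <= m)%N -> N (axpy (-1) (u m) (u n)) <= 4 ^- n.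
  move=> nm; have := @form_sqr_axpy (-1) _ _ (Du m) (Du n).
  have := @form_sqr_axpy 1 _ _ (Du m) (Du n).
  have e_nm : (4 ^- m <= 4 ^- n :> R).
    by rewrite lef_pV2 ?posrE ?exprn_gt0// ler_weXn2l// ler1n.
  (* The midpoint of w_n and w_m lies in W, so its residual has squared norm at least d. *)
  pose wb := axpy (2^-1) (w n) (axpy (2^-1) (w m) (fun=> 0)).
  have Wwb : W wb by apply: (Waxpy) => //; exact: Waxpy.
  have := dle _ Wwb.
  have ub : axpy 1 (u m) (u n) = axpy 1 (axpy (-1) wb h) (axpy (-1) wb h).
    by apply/funext => x; rewrite /u /wb /axpy; field.
  have Dwb : D (axpy (-1) wb h) by apply: D_axpy => //; apply: WD.
  rewrite ub (@form_sqr_axpy 1)// -/(N _) /N.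
  have := Nu n; have := Nu m; rewrite /N; lra.
have [C [k [Dk kC]]] := B_complete Du cau.
exists k; split => // [v Wv|e e0].
  have Dv := WD _ Wv.
  apply/eqP; rewrite -sqrf_eq0 eq_le sqr_ge0 andbT.
  (* The constant is twice the bound [e1] plus twice the bound [e2], from (x - y)^2 <= 2 x^2 + 2
     y^2. *)
  apply: (@le0_of_le_geometric _ ((2 * 4^-1 + 2 * C) * N v)) => n.
  have e1 : B (u n) v ^+ 2 <= 4 ^- n / 4 * N v.
    apply: sqr_le_of_quadratic_ge; [exact: ltW|exact: (B_ge0 Dv)|] => t.
    have Ww' : W (axpy (- t) v (w n)) by exact: Waxpy.
    have := dle _ Ww'.
    have -> : axpy (-1) (axpy (- t) v (w n)) h = axpy t v (u n).
      by apply/funext => x; rewrite /u /axpy; ring.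
    by rewrite /N form_sqr_axpy//; have := Nu n; rewrite /N [B v (u n)]B_sym; lra.
  have Dku : D (axpy (-1) k (u n)) by exact: D_axpy.
  have e2 : B (axpy (-1) k (u n)) v ^+ 2 <= C * 4 ^- n * N v.
    apply: (le_trans (form_cauchy_schwarz Dku Dv)).
    exact: ler_wpM2r (B_ge0 Dv) _ _ (kC n).
  have -> : B k v = B (u n) v - B (axpy (-1) k (u n)) v by rewrite B_axpy//; ring.
  have : (B (u n) v - B (axpy (-1) k (u n)) v) ^+ 2 <=
      2 * B (u n) v ^+ 2 + 2 * B (axpy (-1) k (u n)) v ^+ 2.
    by have := sqr_ge0 (B (u n) v + B (axpy (-1) k (u n)) v); rewrite !expr2; lra.
  move=> /le_trans; apply; lra.
have : ~ (forall n, e <= C * 4 ^- n).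
  by move=> /le0_of_le_geometric; rewrite leNgt e0.
move=> /existsNP[n /negP]; rewrite -ltNge => lt_e.
exists (w n) => //; split; first exact: (D_axpy (-1) Dk (Du n)).
exact: le_trans (kC n) (ltW lt_e).
Qed.

End projection.

                                          

(** * Quadratic forms from the parallelogram law; infima of quadratic energies *)

Lemma additive_bounded_linear (R : realType) (g : R -> R) (M : R) :
  (forall s t, g (s + t) = g s + g t) -> (forall t, 0 <= t <= 1 -> `|g t| <= M) ->
  forall t, g t = t * g 1.
Proof.
move=> gD gM.
have g0 : g 0 = 0 by have := gD 0 0; rewrite addr0; lra.
have gn n t : g (n%:R * t) = n%:R * g t.
  elim: n => [|n IH]; first by rewrite !mul0r g0.
  by rewrite -[n.+1]addn1 natrD !mulrDl gD IH !mul1r.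
have pos t : 0 <= t -> g t = t * g 1.
  move=> t0; apply/eqP; rewrite -subr_eq0 -normr_le0.
  apply/ler_addgt0Pl => e e0; rewrite addr0.
  set C := M + `|g 1|.
  have C0 : 0 <= C.
    by rewrite addr_ge0// (le_trans _ (gM 0 _)) ?lexx ?ler01.
  have [n nC] : exists n : nat, C / e < n.+1%:R.
    exists (Num.truncn (C / e)); by rewrite truncnS_gt.
  have nt0 : 0 <= n.+1%:R * t by rewrite mulr_ge0.
  (* Since (n+1) t = m + s, the defect g t - t g 1 multiplied by n+1 is the defect at s in [0,1],
     which is at most C. *)
  pose m := Num.truncn (n.+1%:R * t); pose s := n.+1%:R * t - m%:R.
  have s01 : 0 <= s <= 1.
    move: (truncn_itv nt0); rewrite /s -/m; move: (n.+1%:R * t) => x.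
    by rewrite -natr1 => /andP[? ?]; apply/andP; split; lra.
  have E : n.+1%:R * (g t - t * g 1) = g s - s * g 1.
    have nts : n.+1%:R * t = m%:R * 1 + s by rewrite /s; ring.
    by rewrite mulrBr mulrA -gn nts gD gn; ring.
  have : `|g s - s * g 1| <= C.
    apply: (le_trans (ler_normB _ _)); rewrite lerD ?gM//.
    rewrite normrM ler_piMl//; case/andP: s01 => ? ?; by rewrite ger0_norm.
  rewrite -E normrM gtr0_norm ?ltr0n// => H.
  rewrite -(@ler_pM2l _ n.+1%:R) ?ltr0n//; apply: (le_trans H).
  by rewrite -ler_pdivrMr// ltW.
move=> t; have [/pos//|/ltW t0] := leP 0 t.
have := gD t (- t); rewrite subrr g0 [g (- t)]pos ?oppr_ge0//; lra.
Qed.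

(** The Jordan-von Neumann theorem. The polar form [C] is biadditive by the parallelogram law, and
    |C a b| <= Q a + Q b makes it bounded on segments, hence homogeneous over the reals. An
    inequality suffices as hypothesis, because substituting l + m and l - m reverses it. *)
Lemma parallelogram_form (R : realType) d (Q : 'cV[R]_d -> R) :
  (forall l, 0 <= Q l) -> (forall a l, Q (a *: l) = a ^+ 2 * Q l) ->
  (forall l m, Q (l + m) + Q (l - m) <= 2 * Q l + 2 * Q m) ->
  exists S : 'M[R]_d, S^T = S /\ forall l : 'cV[R]_d, (l^T *m S *m l) 0 0 = Q l.
Proof.
move=> Q0 QZ Qle.
have QD l m : Q (l + m) + Q (l - m) = 2 * Q l + 2 * Q m.
  apply/eqP; rewrite eq_le Qle /=.
  have := Qle (l + m) (l - m).
  have -> : l + m + (l - m) = 2 *: l.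
    by apply/matrixP => i j; rewrite !mxE; ring.
  have -> : l + m - (l - m) = 2 *: m.
    by apply/matrixP => i j; rewrite !mxE; ring.
  rewrite !QZ; lra.
have QN l : Q (- l) = Q l by rewrite -scaleN1r QZ; ring.
pose C a b := Q (a + b) - Q a - Q b.
have Csym a b : C a b = C b a by rewrite /C [b + a]addrC; ring.
have CD a b c : C (a + b) c = C a c + C b c.
  rewrite /C; have e1 := QD (a + b) c; have e2 := QD a (b - c).
  have e3 := QD (a + c) b; have e4 := QD b c.
  move: e1 e2 e3 e4; rewrite !addrA.
  have -> : a + c + b = a + b + c by rewrite addrAC.
  have -> : a - (b - c) = a + c - b by rewrite opprB addrA addrAC.
  lra.
have Cle a b : `|C a b| <= Q a + Q b.
  rewrite ler_norml; have := QD a b; have := Q0 (a + b); have := Q0 (a - b).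
  rewrite /C; lra.
have CZ a l m : C (a *: l) m = a * C l m.
  have -> := @additive_bounded_linear R (fun t => C (t *: l) m) (Q l + Q m) _ _ a.
  - by rewrite scale1r.
  - by move=> s t; rewrite scalerDl CD.
  - move=> t /andP[t0 t1]; apply: (le_trans (Cle _ _)).
    by rewrite lerD2r QZ ler_piMl// expr2 mulr_ile1.
have C0 m : C 0 m = 0 by rewrite -(scale0r (0 : 'cV[R]_d)) CZ mul0r.
have Csum (a : 'I_d -> R) (v : 'I_d -> 'cV[R]_d) m :
    C (\sum_i a i *: v i) m = \sum_i a i * C (v i) m.
  elim/big_rec2 : _ => [|i x y _ <-]; first exact: C0.
  by rewrite CD CZ.
pose e_ (i : 'I_d) : 'cV[R]_d := delta_mx i 0.
exists (\matrix_(i, j) (C (e_ i) (e_ j) / 2)); split.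
  by apply/matrixP => i j; rewrite !mxE Csym.
move=> l.
have lE : l = \sum_i l i 0 *: e_ i.
  rewrite {1}[l]matrix_sum_delta; apply: eq_bigr => i _.
  by rewrite big_ord1.
have CQ : C l l = 2 * Q l by rewrite /C -mulr2n -scaler_nat QZ; ring.
have CE : C l l = \sum_i l i 0 * \sum_j l j 0 * C (e_ j) (e_ i).
  rewrite {1}lE Csum; apply: eq_bigr => i _; congr (_ * _).
  by rewrite Csym {1}lE Csum.
have -> : Q l = C l l / 2 by rewrite CQ mulrAC divff// mul1r.
rewrite CE mulr_suml mxE; apply: eq_bigr => i _.
rewrite mxE mulrC -mulrA; congr (_ * _).
rewrite mulr_suml; apply: eq_bigr => j _.
by rewrite !mxE mulrA.
Qed.

Section infimum_of_quadratic_energies.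
Context (R : realType) (X : Type) (d : nat).
Context (D : (X -> R) -> Prop) (En : 'cV[R]_d -> (X -> R) -> R).
Hypothesis D0 : D (fun=> 0).
Hypothesis D_axpy : forall a f g, D f -> D g -> D (fun x => a * f x + g x).
Hypothesis En_ge0 : forall l f, D f -> 0 <= En l f.
Hypothesis En_scale : forall a l f, D f -> En (a *: l) (fun x => a * f x) = a ^+ 2 * En l f.
Hypothesis En_parallelogram : forall l m f g, D f -> D g ->
  En (l + m) (fun x => f x + g x) + En (l - m) (fun x => f x - g x) =
  2 * En l f + 2 * En m g.

Definition inf_energy l := inf [set En l f | f in [set f | D f]].

Let D_scale a f : D f -> D (fun x => a * f x).
Proof.
move=> Df; have -> : (fun x => a * f x) = fun x => a * f x + 0 by
  apply/funext => x; rewrite addr0.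
exact: D_axpy.
Qed.

Let D_add f g : D f -> D g -> D (fun x => f x + g x).
Proof.
move=> Df Dg; have -> : (fun x => f x + g x) = fun x => 1 * f x + g x by
  apply/funext => x; rewrite mul1r.
exact: D_axpy.
Qed.

Let D_sub f g : D f -> D g -> D (fun x => f x - g x).
Proof.
move=> Df Dg; have -> : (fun x => f x - g x) = fun x => -1 * g x + f x by
  apply/funext => x; ring.
exact: D_axpy.
Qed.

Lemma inf_energy_has_inf l : has_inf [set En l f | f in [set f | D f]].
Proof.
split; first by exists (En l (fun=> 0)), (fun=> 0).
by exists 0 => _ [f Df <-]; exact: En_ge0.
Qed.

Lemma inf_energy_le l f : D f -> inf_energy l <= En l f.
Proof. by move=> Df; apply: ge_inf; [exact: (inf_energy_has_inf l).2|exists f]. Qed.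

Lemma le_inf_energy l a : (forall f, D f -> a <= En l f) -> a <= inf_energy l.
Proof.
move=> H; apply: lb_le_inf; first exact: (inf_energy_has_inf l).1.
by move=> _ [f Df <-]; exact: H.
Qed.

Lemma inf_energy_adherent l e : 0 < e -> exists2 f, D f & En l f <= inf_energy l + e.
Proof.
move=> e0; have [_ [f Df <-] /ltW H] := inf_adherent e0 (inf_energy_has_inf l).
by exists f.
Qed.

Lemma ereal_inf_energy l :
  ereal_inf [set (En l f)%:E | f in [set f | D f]] = (inf_energy l)%:E.
Proof.
have [A0 A_lb] := inf_energy_has_inf l.
rewrite /inf_energy -ereal_inf_EFin//.
by congr ereal_inf; rewrite -image_comp.
Qed.

(** If f and g are nearly optimal for l and m, then f + g and f - g are competitors for l + m and l
    - m. This gives one half of the parallelogram law for the infimum, which is all that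
    [parallelogram_form] asks. *)
Theorem inf_energy_form : exists S : 'M[R]_d,
  S^T = S /\ forall l : 'cV[R]_d, (l^T *m S *m l) 0 0 = inf_energy l.
Proof.
have Q0 l : 0 <= inf_energy l by apply: le_inf_energy => f; exact: En_ge0.
have Qle a l : inf_energy (a *: l) <= a ^+ 2 * inf_energy l.
  have [->|a0] := eqVneq a 0.
    rewrite expr0n mul0r scale0r; apply: (le_trans (inf_energy_le _ D0)).
    have z : (fun x : X => 0 * (fun=> 0) x) = (fun=> 0) :> (X -> R).
      by apply/funext => x; rewrite mul0r.
    by have := En_scale 0 0 D0; rewrite z scale0r expr0n mul0r => ->.
  rewrite -ler_pdivrMl ?exprn_even_gt0//; apply: le_inf_energy => f Df.
  by rewrite ler_pdivrMl ?exprn_even_gt0// -En_scale//; apply/inf_energy_le/D_scale.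
apply: parallelogram_form => // [a l|l m].
  apply/eqP; rewrite eq_le Qle /=.
  have [->|a0] := eqVneq a 0; first by rewrite expr0n mul0r.
  rewrite -ler_pdivlMl ?exprn_even_gt0// -exprVn.
  by rewrite (le_trans _ (Qle _ _))// scalerA mulVf// scale1r.
apply/ler_addgt0Pr => e e0.
have e4 : 0 < e / 4 by rewrite divr_gt0.
have [f Df fe] := inf_energy_adherent l e4.
have [g Dg ge] := inf_energy_adherent m e4.
have := inf_energy_le (l + m) (D_add Df Dg).
have := inf_energy_le (l - m) (D_sub Df Dg).
have := En_parallelogram l m Df Dg; lra.
Qed.

End infimum_of_quadratic_energies.

                                                   

(** * Means, integrability and square integrability of real functions *)

Section mean.
Context (disp : measure_display) (T : measurableType disp) (R : realType).
Context (mu : probability T R).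
Implicit Types f g : T -> R.

Definition meas f := measurable_fun setT f.
Definition intble f := mu.-integrable setT (EFin \o f).
Definition mean f : R := Rintegral mu setT f.
Definition sqint f := meas f /\ intble (fun x => f x ^+ 2).

Lemma intble_meas f : intble f -> meas f.
Proof. by move=> /measurable_int/measurable_EFinP. Qed.

Lemma meas_axpy a f g : meas f -> meas g -> meas (fun x => a * f x + g x).
Proof. by move=> mf mg; apply: measurable_funD => //; apply: measurable_funM. Qed.

Lemma intble_axpy a f g : intble f -> intble g -> intble (fun x => a * f x + g x).
Proof.
move=> If Ig; rewrite /intble.
have -> : EFin \o (fun x => a * f x + g x) =
  ((fun x => a%:E * (EFin \o f) x) \+ (EFin \o g))%E by apply/funext.
by apply: integrableD => //; apply: integrableZl.
Qed.

Lemma mean_axpy a f g : intble f -> intble g ->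
  mean (fun x => a * f x + g x) = a * mean f + mean g.
Proof.
move=> If Ig; rewrite /mean RintegralD//; first by rewrite RintegralZl.
have -> : EFin \o (fun x => a * f x) = (fun x => a%:E * (EFin \o f) x)%E
  by apply/funext.
exact: integrableZl.
Qed.

Lemma mean_cst (a : R) : mean (fun=> a) = a.
Proof.
have e : fine (mu setT) = 1 by rewrite probability_setT.
by rewrite /mean Rintegral_cst//; apply: (etrans (congr1 ( *%R a) e)); rewrite mulr1.
Qed.

Lemma intble_cst (a : R) : intble (fun=> a).
Proof. exact: finite_measure_integrable_cst. Qed.

Lemma intbleD f g : intble f -> intble g -> intble (fun x => f x + g x).
Proof.
by move=> /(intble_axpy 1) H /H; rewrite /intble; under eq_fun do rewrite mul1r.
Qed.

Lemma intbleZ a f : intble f -> intble (fun x => a * f x).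
Proof.
move=> /(intble_axpy a) /(_ (intble_cst 0)).
by under eq_fun do rewrite addr0.
Qed.

Lemma intbleB f g : intble f -> intble g -> intble (fun x => f x - g x).
Proof.
move=> If /(intble_axpy (-1)) /(_ If).
by under eq_fun do rewrite mulN1r addrC.
Qed.

Lemma meanD f g : intble f -> intble g -> mean (fun x => f x + g x) = mean f + mean g.
Proof. by move=> *; rewrite /mean RintegralD. Qed.

Lemma meanB f g : intble f -> intble g -> mean (fun x => f x - g x) = mean f - mean g.
Proof. by move=> *; rewrite /mean RintegralB. Qed.

Lemma meanZ a f : intble f -> mean (fun x => a * f x) = a * mean f.
Proof. by move=> *; rewrite /mean RintegralZl. Qed.

Lemma intble_sum I (s : seq I) (F : I -> T -> R) :
  (forall i, intble (F i)) -> intble (fun x => \sum_(i <- s) F i x).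
Proof.
move=> IF; elim: s => [|i s IH].
  by under eq_fun do rewrite big_nil; exact: intble_cst.
by under eq_fun do rewrite big_cons; exact: intbleD.
Qed.

Lemma mean_sum I (s : seq I) (F : I -> T -> R) :
  (forall i, intble (F i)) -> mean (fun x => \sum_(i <- s) F i x) = \sum_(i <- s) mean (F i).
Proof.
move=> IF; elim: s => [|i s IH].
  by under eq_fun do rewrite big_nil; rewrite big_nil mean_cst.
under eq_fun do rewrite big_cons.
by rewrite big_cons -IH meanD//; exact: intble_sum.
Qed.

Lemma le_mean f g : intble f -> intble g -> (forall x, f x <= g x) -> mean f <= mean g.
Proof. by move=> If Ig fg; apply: le_Rintegral. Qed.

Lemma mean_ge0 f : (forall x, 0 <= f x) -> 0 <= mean f.
Proof. by move=> f0; apply: Rintegral_ge0. Qed.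

Lemma intble_le f g : meas f -> intble g -> (forall x, `|f x| <= g x) -> intble f.
Proof.
move=> mf Ig fg; apply: (@le_integrable _ _ _ _ setT measurableT _ (EFin \o g)) => //.
  exact/measurable_EFinP.
by move=> x _ /=; rewrite lee_fin (le_trans (fg x))// ler_norm.
Qed.

Lemma intble_bounded f (C : R) : meas f -> (forall x, `|f x| <= C) -> intble f.
Proof. by move=> mf; apply: intble_le => //; exact: intble_cst. Qed.

Lemma intble_norm f : intble f -> intble (fun x => `|f x|).
Proof.
move=> If; have mf := intble_meas If.
have := integrable_norm If; apply: eq_integrable => //.
Qed.

Lemma mean_norm f : intble f -> `|mean f| <= mean (fun x => `|f x|).
Proof. by move=> If; apply: le_normr_Rintegral. Qed.

Lemma meas_sqr f : meas f -> meas (fun x => f x ^+ 2).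
Proof. exact: measurable_funX. Qed.

Lemma sqint_mul f g : sqint f -> sqint g -> intble (fun x => f x * g x).
Proof.
move=> [mf If] [mg Ig]; apply: (intble_le _ (intbleD If Ig)).
  exact: measurable_funM.
move=> x; rewrite ler_norml.
have := sqr_ge0 (f x + g x); have := sqr_ge0 (f x - g x).
have := sqr_ge0 (f x); have := sqr_ge0 (g x).
by rewrite !expr2; lra.
Qed.

Lemma sqint_axpy a f g : sqint f -> sqint g -> sqint (fun x => a * f x + g x).
Proof.
move=> [mf If] [mg Ig]; split; first exact: meas_axpy.
have mfg : meas (fun x => (a * f x + g x) ^+ 2) by apply/meas_sqr/meas_axpy.
apply: (intble_le mfg (intbleD (intbleZ (2 * a ^+ 2) If) (intbleZ 2 Ig))) => x.
rewrite ger0_norm ?sqr_ge0//.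
have := sqr_ge0 (a * f x - g x); rewrite !expr2; lra.
Qed.

Lemma sqint_cst (a : R) : sqint (fun=> a).
Proof. by split; [exact: measurable_cst|exact: intble_cst]. Qed.

Lemma sqintZ a f : sqint f -> sqint (fun x => a * f x).
Proof.
move=> /(sqint_axpy a) /(_ (sqint_cst 0)).
by under eq_fun do rewrite addr0.
Qed.

Lemma sqintD f g : sqint f -> sqint g -> sqint (fun x => f x + g x).
Proof.
by move=> /(sqint_axpy 1) H /H; under eq_fun do rewrite mul1r.
Qed.

Lemma sqintB f g : sqint f -> sqint g -> sqint (fun x => f x - g x).
Proof.
move=> Hf /(sqint_axpy (-1)) /(_ Hf).
by under eq_fun do rewrite mulN1r addrC.
Qed.

Lemma sqint_intble f : sqint f -> intble f.
Proof.
by move=> Hf; have := sqint_mul Hf (sqint_cst 1); under eq_fun do rewrite mulr1.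
Qed.

Lemma sqint_bounded f (C : R) : meas f -> (forall x, `|f x| <= C) -> sqint f.
Proof.
move=> mf fC; split=> //; apply: (@intble_bounded _ (C ^+ 2)); first exact: meas_sqr.
by move=> x; rewrite normrX lerXn2r// ?nnegrE// (le_trans _ (fC x)).
Qed.

Lemma sqint_weight w f (C : R) : meas w -> (forall x, `|w x| <= C) -> sqint f ->
  sqint (fun x => w x * f x).
Proof.
move=> mw wC [mf If]; split; first exact: measurable_funM.
apply: (intble_le _ (intbleZ (C ^+ 2) If)).
  by apply/meas_sqr/measurable_funM.
move=> x; rewrite normrX normrM exprMn -[`|f x| ^+ 2]normrX.
rewrite [`|f x ^+ 2|]ger0_norm ?sqr_ge0//.
by rewrite ler_wpM2r ?sqr_ge0// lerXn2r// ?nnegrE// (le_trans _ (wC x)).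
Qed.

Lemma intble_weight w f (C : R) : meas w -> (forall x, `|w x| <= C) -> intble f ->
  intble (fun x => w x * f x).
Proof.
move=> mw wC If; have mf := intble_meas If.
apply: (intble_le _ (intbleZ C (intble_norm If))); first exact: measurable_funM.
by move=> x; rewrite normrM ler_wpM2r.
Qed.

Lemma mean_ae f g : meas f -> meas g -> {ae mu, forall x, f x = g x} -> mean f = mean g.
Proof.
move=> mf mg fg; congr fine; apply: ae_eq_integral => //; try exact/measurable_EFinP.
by apply: filterS fg => x -> _.
Qed.

Lemma mean_ge0_eq0 f : intble f -> {ae mu, forall x, 0 <= f x} -> mean f = 0 ->
  {ae mu, forall x, f x = 0}.
Proof.
move=> If f0 mf0; have mf := intble_meas If.
have mEf : measurable_fun setT (EFin \o f) by exact/measurable_EFinP.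
have [+ _] := ae_eq_integral_abs mu measurableT mEf.
have e0 : (\int[mu]_(x in setT) `|(EFin \o f) x| = 0)%E.
  rewrite (@ae_eq_integral _ _ _ mu setT (EFin \o f))//; last 2 first.
  - exact: measurableT_comp.
  - by apply: filterS f0 => x fx _ /=; rewrite ger0_norm.
  have := integrable_fin_num measurableT If => /fineK <-.
  by move: mf0; rewrite /mean /Rintegral => ->.
by move=> /(_ e0); apply: filterS => x /(_ I) [].
Qed.

Lemma mean_sqr_eq0 f : sqint f -> mean (fun x => f x ^+ 2) = 0 ->
  {ae mu, forall x, f x = 0}.
Proof.
move=> [mf If] /(mean_ge0_eq0 If) H.
have : {ae mu, forall x, f x ^+ 2 = 0} by apply: H; apply: nearW => x; exact: sqr_ge0.
by apply: filterS => x /eqP; rewrite sqrf_eq0 => /eqP.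
Qed.

(** Integrate |f| <= f^2 / (2 e) + e / 2. *)
Lemma mean_norm_le_of_sqr f (e : R) : 0 < e -> sqint f ->
  mean (fun x => f x ^+ 2) <= e ^+ 2 -> mean (fun x => `|f x|) <= e.
Proof.
move=> e0 Hf fe; have [mf If] := Hf.
have : mean (fun x => `|f x|) <= mean (fun x => (2 * e)^-1 * (f x ^+ 2) + e / 2).
  apply: le_mean; first exact: (intble_norm (sqint_intble Hf)).
    exact: (intble_axpy _ If (intble_cst _)).
  move=> x; rewrite -(ler_pM2l (_ : 0 < 2 * e)) ?mulr_gt0//.
  rewrite mulrDr mulrA divff ?mul1r ?mulf_neq0 ?gt_eqF//.
  have -> : 2 * e * (e / 2) = e ^+ 2 by field.
  by rewrite -[f x ^+ 2]real_normK ?num_real//; have := sqr_ge0 (`|f x| - e); rewrite !expr2; lra.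
move=> /le_trans; apply; rewrite mean_axpy ?mean_cst//; last exact: intble_cst.
rewrite -(ler_pM2l (_ : 0 < 2 * e)) ?mulr_gt0//.
rewrite mulrDr mulrA divff ?mul1r ?mulf_neq0 ?gt_eqF//.
have -> : 2 * e * (e / 2) = e ^+ 2 by field.
by move: fe; rewrite !expr2; lra.
Qed.

(** The bridge from the space L^2 in the definition of the form to [sqint], the notion used in all
    the estimates. *)
Lemma LfunP2 f : f \in Lfun mu 2%:E <-> sqint f.
Proof.
split=> [Hf|[mf If]].
  split; last exact: Lfun2_integrable_sqr.
  by move: Hf => /(sub_Lfun_mfun); rewrite inE.
rewrite inE; apply/andP; split; rewrite inE//= /finite_norm unlock /Lnorm.
rewrite poweR_lty//.
move/integrableP : If => [_]; apply: le_lt_trans.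
rewrite le_eqVlt; apply/orP; left; apply/eqP; apply: eq_integral => x _ /=.
by rewrite normrX powR_mulrn.
Qed.

End mean.

                                                      

(** * Completeness of L^2, truncation, and projection for weighted vector fields *)

Lemma cvgn_of_summable_increments (R : realType) (u : R^nat) (M : R) :
  (forall n, \sum_(0 <= k < n) `|u k.+1 - u k| <= M) -> cvgn u.
Proof.
move=> uM.
have : cvgn [normed series (telescope u)].
  apply: nondecreasing_is_cvgn.
    by apply: nondecreasing_series => n _ _; rewrite normr_ge0.
  by exists M => _ [n _ <-]; exact: uM.
move=> /normed_cvg/cvg_ex[l ul]; apply/cvg_ex; exists (u 0%N + l).
move: (u 0%N) (fun n => eq_sum_telescope u n) => u0 uE.
by rewrite (funext uE); apply: cvgD => //; exact: cvg_cst.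
Qed.

Section completeness.
Context (disp : measure_display) (T : measurableType disp) (R : realType).
Context (mu : probability T R).

(** The sum of all the increments has integral at most 2 C, so it is finite almost everywhere. *)
Lemma ae_cvg_of_summable_increments (u : nat -> T -> R) (C : R) : 0 <= C ->
  (forall n, meas (u n)) ->
  (forall n, intble mu (fun x => `|u n.+1 x - u n x|)) ->
  (forall n, mean mu (fun x => `|u n.+1 x - u n x|) <= C * 2 ^- n) ->
  {ae mu, forall x, cvgn (u ^~ x)}.
Proof.
move=> C0 mu_ Ia aC.
pose a n x := (`|u n.+1 x - u n x|)%:E.
have ma n : measurable_fun setT (a n) by apply/measurable_EFinP; exact: intble_meas (Ia n).
have a0 n x : (0 <= a n x)%E by rewrite lee_fin.
pose g x := (\sum_(0 <= n <oo) a n x)%E.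
have mg : measurable_fun setT g by apply: ge0_emeasurable_sum.
have g0 x : (0 <= g x)%E by apply: nneseries_ge0.
have Ig : mu.-integrable setT g.
  apply/integrableP; split => //.
  have -> : (\int[mu]_x `|g x| = \int[mu]_x g x)%E.
    by apply: eq_integral => x _; rewrite gee0_abs.
  rewrite integral_nneseries//.
  apply: (@le_lt_trans _ _ (2 * C)%:E); last by rewrite ltry.
  apply: lime_le; first by apply: is_cvg_nneseries => n _ _; apply: integral_ge0.
  apply: nearW => N.
  apply: (@le_trans _ _ (\sum_(0 <= n < N) (C * 2 ^- n))%:E); last first.
    rewrite lee_fin -mulr_sumr mulrC ler_wpM2r//.
    have -> : \sum_(0 <= i < N) 2 ^- i = 2 - 2 * 2 ^- N :> R.
      elim: N => [|N IH]; first by rewrite big_nil expr0 invr1; ring.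
      rewrite big_nat_recr//= IH exprS invfM; field.
      by rewrite expf_neq0.
    by rewrite lerBlDr lerDl mulr_ge0// invr_ge0 exprn_ge0.
  rewrite -sumEFin; apply: lee_sum => n _.
  have := integrable_fin_num measurableT (Ia n) => /fineK <-.
  by rewrite lee_fin; exact: aC.
have := integrable_ae measurableT Ig.
apply: filterS => x /(_ Logic.I) gx.
apply: (@cvgn_of_summable_increments _ _ (fine (g x))) => n.
rewrite -lee_fin fineK// -sumEFin.
exact: (@nneseries_lim_ge _ (a ^~ x) xpredT 0%N n).
Qed.

Lemma einf_le_of_le (v : (\bar R)^nat) n (l : \bar R) :
  (forall m, (n <= m)%N -> (v m <= l)%E) -> (limn_einf v <= l)%E.
Proof.
move=> H; rewrite limn_einf_lim; apply: lime_le; first exact: is_cvg_einfs.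
near=> k; have nk : (n <= k)%N by near: k; exists n.
apply: (@le_trans _ _ (v k)); last exact: H.
by apply: ereal_inf_lbound; exists k => //=.
Unshelve. all: by end_near. Qed.

(** Riesz-Fischer with the rate kept: the sequence converges almost everywhere, and Fatou's lemma in
    m passes the bound on u_n - u_m to the limit. *)
Lemma sqint_complete (u : nat -> T -> R) (c : R) : 0 <= c ->
  (forall n, sqint mu (u n)) ->
  (forall n m, (n <= m)%N -> mean mu (fun x => (u n x - u m x) ^+ 2) <= c * 4 ^- n) ->
  exists2 v, sqint mu v & forall n, mean mu (fun x => (u n x - v x) ^+ 2) <= c * 4 ^- n.
Proof.
move=> c0 Su uc.
have Sd n m : sqint mu (fun x => u n x - u m x) by apply: sqintB.
have cv : {ae mu, forall x, cvgn (u ^~ x)}.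
  (* 1 + c is positive and its square dominates c, so it serves in place of a square root of c. *)
  apply: (@ae_cvg_of_summable_increments _ (1 + c)).
  - by rewrite addr_ge0.
  - by move=> n; exact: (Su n).1.
  - by move=> n; apply: intble_norm; apply: sqint_intble; exact: Sd.
  move=> n; apply: mean_norm_le_of_sqr => //.
    by rewrite mulr_gt0// ?invr_gt0 ?exprn_gt0// ltr_wpDr.
  have := uc n n.+1 (leqnSn n).
  under eq_fun => x do rewrite -[u n x - _]opprB sqrrN.
  move=> /le_trans; apply.
  have -> : ((1 + c) * 2 ^- n) ^+ 2 = (1 + c) ^+ 2 * 4 ^- n.
    rewrite exprMn exprVn -exprM mulnC exprM.
    by have -> : (2 : R) ^+ 2 = 4 by ring.
  by rewrite ler_wpM2r ?invr_ge0 ?exprn_ge0// expr2; nra.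
(* The upper limit is measurable on the whole space and equals the limit wherever there is one. *)
pose v x := fine (limn_esup (fun n => (u n x)%:E)).
have mv : meas v.
  apply: measurableT_comp; first exact: fine_measurable.
  by apply: measurable_fun_limn_esup => n; apply/measurable_EFinP; exact: (Su n).1.
have uv : {ae mu, forall x, (u ^~ x) @ \oo --> v x}.
  apply: filterS cv => x /cvg_ex[l ul].
  have : (fun n => (u n x)%:E) @ \oo --> l%:E by apply: cvg_EFin; first exact: nearW.
  by move=> /cvg_limn_einf_sup[_ e]; rewrite /v e.
have msq n : meas (fun x => (u n x - v x) ^+ 2).
  by apply: meas_sqr; apply: measurable_funB => //; exact: (Su n).1.
have fat n : (\int[mu]_x ((u n x - v x) ^+ 2)%:E <= (c * 4 ^- n)%:E)%E.
  have mf m : measurable_fun setT (fun x => ((u n x - u m x) ^+ 2)%:E).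
    by apply/measurable_EFinP; apply: meas_sqr; exact: (Sd n m).1.
  have -> : (\int[mu]_x ((u n x - v x) ^+ 2)%:E =
     \int[mu]_x (limn_einf (fun m => ((u n x - u m x) ^+ 2)%:E)))%E.
    apply: ae_eq_integral => //; first exact/measurable_EFinP/msq.
      rewrite (_ : (fun x => _) =
        (fun x => - limn_esup (fun m => - ((u n x - u m x) ^+ 2)%:E))%E).
        apply: measurableT_comp => //; apply: measurable_fun_limn_esup => m.
        exact: measurableT_comp.
      by apply/funext => x; rewrite -limn_einfN; congr limn_einf;
        apply/funext => m; rewrite /= ?oppeK ?opprK.
    apply: filterS uv => x ux _; apply/esym.
    apply: (@cvg_limn_einf_sup _ _ _ _).1; apply: cvg_EFin; first exact: nearW.
    have uv' : (fun m => u n x - u m x) @ \oo --> u n x - v x.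
      by apply: cvgB => //; exact: cvg_cst.
    by rewrite /comp /= expr2; under eq_fun do rewrite expr2; exact: cvgM.
  apply: (le_trans (fatou mu measurableT mf _)).
    by move=> m x _; rewrite lee_fin sqr_ge0.
  apply: (@einf_le_of_le _ n) => m nm.
  have := integrable_fin_num measurableT (Sd n m).2 => /fineK <-.
  by rewrite lee_fin; exact: uc.
have Suv n : sqint mu (fun x => u n x - v x).
  split; first by apply: measurable_funB => //; exact: (Su n).1.
  apply/integrableP; split; first exact/measurable_EFinP/msq.
  under eq_integral do rewrite /= ger0_norm ?sqr_ge0//.
  exact: le_lt_trans (fat n) (ltry _).
exists v.
  have := sqintB (Su 0%N) (Suv 0%N).
  by congr sqint; apply/funext => x; ring.
move=> n; rewrite -lee_fin.
by have := integrable_fin_num measurableT (Suv n).2 => /fineK ->; exact: fat.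
Qed.

Definition clip (M : R) (t : R) := Num.max (- M) (Num.min M t).

Lemma clip_bounded M t : 0 <= M -> `|clip M t| <= M.
Proof.
move=> M0; rewrite /clip ler_norml le_max lexx /= ge_max ge_min lexx /=.
by rewrite (le_trans _ M0)// oppr_le0.
Qed.

Lemma clip_id M t : `|t| <= M -> clip M t = t.
Proof. by rewrite ler_norml => /andP[a b]; rewrite /clip min_r// max_r. Qed.

Lemma clip_dist M t : 0 <= M -> `|t - clip M t| <= `|t|.
Proof.
move=> M0; rewrite /clip; case: (lerP M t) => H; case: (lerP (- M) _) => H2.
- by rewrite !ger0_norm; lra.
- lra.
- by rewrite subrr normr0.
- by rewrite !ler0_norm; lra.
Qed.

Lemma meas_clip M (f : T -> R) : meas f -> meas (fun x => clip M (f x)).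
Proof.
move=> mf; apply: (@measurable_maxr _ _ _ setT (cst (- M)) (fun x => Num.min M (f x))) => //.
exact: (@measurable_minr _ _ _ setT (cst M) f).
Qed.

(** Truncate f at level n. At each point the truncation is eventually exact, and f^2 dominates the
    squared error. *)
Lemma sqint_bounded_approx f (e : R) : 0 < e -> sqint mu f ->
  exists g M, [/\ meas g, forall x, `|g x| <= M & mean mu (fun x => (f x - g x) ^+ 2) <= e].
Proof.
move=> e0 [mf If].
have cl n (x : T) : `|f x - clip n%:R (f x)| ^+ 2 <= f x ^+ 2.
  by rewrite -[leRHS]real_normK ?num_real// lerXn2r ?nnegrE// clip_dist.
have mg n : meas (fun x => (f x - clip n%:R (f x)) ^+ 2).
  by apply: meas_sqr; apply: measurable_funB => //; exact: meas_clip.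
have := @dominated_cvg _ _ _ mu setT measurableT
  (fun n x => ((f x - clip n%:R (f x)) ^+ 2)%:E) (cst 0%E) (fun x => (f x ^+ 2)%:E).
rewrite integral0 => H.
have {}H : (fun n => \int[mu]_x ((f x - clip n%:R (f x)) ^+ 2)%:E)%E @ \oo --> 0%E.
  apply: H => //.
  - by move=> n; exact/measurable_EFinP/mg.
  - move=> x _; apply: cvg_near_cst.
    near=> n; rewrite clip_id ?subrr ?expr0n//.
    by near: n; exact: nbhs_infty_ger.
  - by move=> n x _; rewrite lee_fin normrX.
have /fine_cvgP[_] := H.
move=> /cvgrPdist_le /(_ e e0)[n _ /(_ n (leqnn n))] /=.
rewrite sub0r normrN => le_e.
exists (fun x => clip n%:R (f x)), n%:R; split.
- exact: meas_clip.
- by move=> x; exact: clip_bounded.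
- exact: le_trans (ler_norm _) le_e.
Unshelve. all: by end_near. Qed.

End completeness.

Section weighted.
Context (disp : measure_display) (T : measurableType disp) (R : realType).
Context (mu : probability T R) (m : nat) (w : 'I_m -> T -> R) (c : R).
Hypothesis w_meas : forall i, meas (w i).
Hypothesis c_gt0 : 0 < c.
Hypothesis w_itv : forall i t, c^-1 <= w i t <= c.

Local Notation X := ('I_m * T)%type.

Let vD (f : X -> R) := forall i, sqint mu (fun t => f (i, t)).
Let vB (f g : X -> R) := \sum_i mean mu (fun t => w i t * (f (i, t) * g (i, t))).

Lemma weight_norm i t : `|w i t| <= c.
Proof.
have /andP[a b] := w_itv i t; rewrite ger0_norm//.
by rewrite (le_trans _ a)// invr_ge0 ltW.
Qed.

Lemma weighted_intble i f g : sqint mu f -> sqint mu g ->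
  intble mu (fun t => w i t * (f t * g t)).
Proof.
by move=> Hf Hg; apply: (intble_weight (w_meas i) (weight_norm i)); exact: sqint_mul.
Qed.

Let vB_axpy a f g h : vD f -> vD g -> vD h ->
  vB (axpy a f g) h = a * vB f h + vB g h.
Proof.
move=> Df Dg Dh; rewrite /vB mulr_sumr -big_split; apply: eq_bigr => i _ /=.
rewrite -mean_axpy; try exact: weighted_intble.
by congr mean; apply/funext => t; rewrite /axpy; ring.
Qed.

Let mean_le_vB f i : vD f -> mean mu (fun t => f (i, t) ^+ 2) <= c * vB f f.
Proof.
move=> Df; rewrite /vB mulr_sumr (bigD1 i)//= -meanZ; last exact: weighted_intble.
apply: (@le_trans _ _ (mean mu (fun t => c * (w i t * (f (i, t) * f (i, t)))))).
  apply: le_mean; [exact: (Df i).2|by apply/intbleZ/weighted_intble|] => t.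
  have /andP[a _] := w_itv i t.
  rewrite mulrA -expr2 ler_peMl ?sqr_ge0//.
  by rewrite -(divff (lt0r_neq0 c_gt0)) ler_wpM2l// ltW.
rewrite lerDl sumr_ge0// => j _; rewrite mulr_ge0 ?(ltW c_gt0)//.
apply: mean_ge0 => t; rewrite mulr_ge0// -?expr2 ?sqr_ge0//.
by have /andP[+ _] := w_itv j t; apply: le_trans; rewrite invr_ge0 ltW.
Qed.

(** A vector field is read as a scalar function on ['I_m * T], so that [orthogonal_residual] applies
    to the form sum_i <w_i f_i g_i>. The two bounds on the weights make its norm equivalent to that
    of L^2, whence completeness. *)
Theorem weighted_orthogonal_residual (W : ('I_m -> T -> R) -> Prop) h :
  W (fun _ _ => 0) -> (forall f, W f -> forall i, sqint mu (f i)) ->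
  (forall a f g, W f -> W g -> W (fun i t => a * f i t + g i t)) ->
  (forall i, sqint mu (h i)) ->
  exists k, [/\ forall i, sqint mu (k i),
    (forall v, W v -> \sum_i mean mu (fun t => w i t * (k i t * v i t)) = 0) &
    forall e, 0 < e -> exists2 v, W v &
      forall i, mean mu (fun t => (h i t - v i t - k i t) ^+ 2) <= e].
Proof.
move=> W0 WD Waxpy Dh.
have D_axpy a f g : vD f -> vD g -> vD (axpy a f g).
  by move=> Df Dg i; exact: sqint_axpy.
have B_ge0 f : vD f -> 0 <= vB f f.
  move=> Df; apply: sumr_ge0 => i _; apply: mean_ge0 => t.
  rewrite mulr_ge0// -?expr2 ?sqr_ge0//.
  by have /andP[+ _] := w_itv i t; apply: le_trans; rewrite invr_ge0 ltW.
have B_sym f g : vB f g = vB g f.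
  apply: eq_bigr => i _; congr mean; apply/funext => t; ring.
have B_complete u : (forall n, vD (u n)) -> (forall n k, (n <= k)%N ->
     vB (axpy (-1) (u k) (u n)) (axpy (-1) (u k) (u n)) <= 4 ^- n) ->
  exists C v, vD v /\
    forall n, vB (axpy (-1) v (u n)) (axpy (-1) v (u n)) <= C * 4 ^- n.
  move=> Du cau.
  have /choice[v v_] : forall i, exists v, sqint mu v /\ forall n,
      mean mu (fun t => (u n (i, t) - v t) ^+ 2) <= c * 4 ^- n.
    move=> i; have [||n k nk|v ? ?] := @sqint_complete _ _ _ mu (fun n t => u n (i, t)) c.
    - exact: ltW.
    - by move=> n; exact: (Du n).
    - apply: (@le_trans _ _ (c * vB (axpy (-1) (u k) (u n)) (axpy (-1) (u k) (u n)))).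
        apply: le_trans (mean_le_vB i (D_axpy _ _ _ (Du k) (Du n))).
        rewrite le_eqVlt; apply/orP; left; apply/eqP; congr mean.
        by apply/funext => t; rewrite /axpy mulN1r addrC.
      by rewrite ler_wpM2l ?cau// ltW.
    - by exists v.
  (* One factor c comes from the L^2 rate of each component, the other from the upper bound of the
     weight. *)
  exists (\sum_(i < m) c * c), (fun p => v p.1 p.2); split=> [i|n]; first exact: (v_ i).1.
  rewrite mulr_suml; apply: ler_sum => i _.
  have Sv : sqint mu (fun t => u n (i, t) - v i t).
    by apply: sqintB; [exact: (Du n i)|exact: (v_ i).1].
  apply: (@le_trans _ _ (mean mu (fun t => c * (u n (i, t) - v i t) ^+ 2))).
    apply: le_mean; last first.
    - move=> t; rewrite /axpy /= mulN1r addrC -expr2 ler_wpM2r ?sqr_ge0//.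
      by case/andP: (w_itv i t).
    - by apply: intbleZ; exact: Sv.2.
    - have S' : sqint mu (fun t => axpy (-1) (fun p : X => v p.1 p.2) (u n) (i, t)).
        by apply: sqint_axpy; [exact: (v_ i).1|exact: (Du n i)].
      exact: weighted_intble.
  rewrite meanZ; last exact: Sv.2.
  by rewrite -mulrA ler_wpM2l ?(v_ i).2// ltW.
have [||||k [Dk kW kh]] := @orthogonal_residual R X vD vB D_axpy B_sym vB_axpy B_ge0
  B_complete (fun f => W (fun i t => f (i, t))) (fun p => h p.1 p.2).
- exact: W0.
- by move=> f Wf i; exact: (WD _ Wf).
- by move=> a f g Wf Wg; exact: (Waxpy a _ _ Wf Wg).
- exact: Dh.
exists (fun i t => k (i, t)); split => [//|v Wv|e e0].
  exact: (kW (fun p => v p.1 p.2) Wv).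
have [v Wv [Dr Br]] := kh _ (divr_gt0 e0 c_gt0).
exists (fun i t => v (i, t)) => // i.
apply: (@le_trans _ _ (c * (e / c))); last by rewrite mulrC divfK// gt_eqF.
apply: le_trans (ler_wpM2l (ltW c_gt0) Br).
apply: le_trans (mean_le_vB i Dr).
rewrite le_eqVlt; apply/orP; left; apply/eqP; congr mean.
by apply/funext => t; rewrite /axpy /=; congr (_ ^+ 2); ring.
Qed.

End weighted.

                                                  

(** * The lattice action: invariance of means, and ergodicity for functions *)

Lemma row_int_additive_ind d (P : 'rV[int]_d -> Prop) (x : 'rV[int]_d) :
  P 0 -> (forall y z, P y -> P z -> P (y + z)) ->
  (forall i, P (x 0 i *: unitZ i)) -> P x.
Proof. by move=> P0 PD Px; rewrite [x]row_sum_delta; elim/big_ind : _. Qed.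

(** The generators are taken to be -e_i because [gradD] shifts by [- unitZ i]. *)
Lemma lattice_ind d (P : 'rV[int]_d -> Prop) :
  P 0 -> (forall y z, P y -> P z -> P (y + z)) -> (forall y, P y -> P (- y)) ->
  (forall i, P (- unitZ i)) -> forall x, P x.
Proof.
move=> P0 PD PN Pe x; apply: row_int_additive_ind => // i.
have Pn (n : nat) : P (n%:Z *: unitZ i).
  elim: n => [|n IH]; first by rewrite scale0r.
  rewrite intS scalerDl scale1r; apply: PD => //.
  by rewrite -[unitZ i]opprK; exact: PN.
by case: (x 0 i) => n; [exact: Pn|rewrite NegzE scaleNr; exact/PN/Pn].
Qed.

Section action.
Context (disp : measure_display) (T : measurableType disp) (R : realType).
Context (mu : probability T R) (d : nat) (tau : 'rV[int]_d -> T -> T).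
Hypothesis tauE : ergodic_action mu tau.
Implicit Types f g : T -> R.

Lemma tauK x eta : tau (- x) (tau x eta) = eta.
Proof. by rewrite -(actionD tauE) addNr (action0 tauE). Qed.

Lemma tauKV x eta : tau x (tau (- x) eta) = eta.
Proof. by rewrite -(actionD tauE) subrr (action0 tauE). Qed.

(** Invariance of mu is assumed for images, whereas changes of variables need preimages; the group
    law exchanges them. *)
Lemma tau_preimage x (B : set T) : tau x @^-1` B = tau (- x) @` B.
Proof.
apply/seteqP; split => eta /=.
  by move=> Be; exists (tau x eta) => //; rewrite tauK.
by move=> [y By <-]; rewrite tauKV.
Qed.

Lemma mu_tau_preimage x B : measurable B -> mu (tau x @^-1` B) = mu B.
Proof. by move=> mB; rewrite tau_preimage (action_preserving tauE). Qed.

Lemma meas_tau x f : meas f -> meas (fun eta => f (tau x eta)).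
Proof. by move=> mf; apply: measurableT_comp => //; exact: (action_measurable tauE). Qed.

Lemma ge0_integral_tau x (f : T -> \bar R) : measurable_fun setT f ->
  (forall eta, 0 <= f eta)%E -> (\int[mu]_eta f (tau x eta) = \int[mu]_eta f eta)%E.
Proof.
move=> mf f0; have mt := action_measurable tauE x.
have := ge0_integral_pushforward mt mu measurableT mf.
rewrite preimage_setT => /(_ (fun _ _ => f0 _)) <-.
by apply: eq_measure_integral => A mA _; exact: mu_tau_preimage.
Qed.

Lemma intble_tau x f : intble mu f -> intble mu (fun eta => f (tau x eta)).
Proof.
move=> If; have mf := intble_meas If; apply/integrableP; split.
  by apply/measurable_EFinP; exact: meas_tau.
rewrite (ge0_integral_tau x (f := fun eta => `|(f eta)%:E|%E))//.
- by case/integrableP : If.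
- by apply: measurableT_comp => //; exact/measurable_EFinP.
Qed.

Lemma mean_tau x f : intble mu f -> mean mu (fun eta => f (tau x eta)) = mean mu f.
Proof.
move=> If; have mf := intble_meas If; congr fine; have mt := action_measurable tauE x.
transitivity (\int[pushforward mu (tau x)]_eta (f eta)%:E)%E; last first.
  by apply: eq_measure_integral => A mA _; exact: mu_tau_preimage.
rewrite (integral_pushforward mt)//.
- exact/measurable_EFinP.
- by rewrite preimage_setT; exact: intble_tau.
Qed.

Lemma sqint_tau x f : sqint mu f -> sqint mu (fun eta => f (tau x eta)).
Proof. by move=> [mf If]; split; [exact: meas_tau|exact: (intble_tau x If)]. Qed.

Lemma ae_tau x (P : T -> Prop) : {ae mu, forall eta, P eta} ->
  {ae mu, forall eta, P (tau x eta)}.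
Proof.
move=> [B [mB B0 PB]]; exists (tau x @^-1` B); split.
- by rewrite -[_ @^-1` _]setTI; exact: (action_measurable tauE x).
- by rewrite mu_tau_preimage.
- by move=> eta /= nP; apply: PB.
Qed.

Lemma ae_invariant r : (forall i, {ae mu, forall eta, r (tau (- unitZ i) eta) = r eta}) ->
  forall x, {ae mu, forall eta, r (tau x eta) = r eta :> R}.
Proof.
move=> rE; apply: lattice_ind => //.
- by apply: nearW => eta; rewrite (action0 tauE).
- move=> y z Py Pz; have := ae_tau z Py; apply: filterS2 Pz => eta e1 e2.
  by rewrite (actionD tauE) e2 e1.
- by move=> y /(ae_tau (- y)); apply: filterS => eta; rewrite tauKV => ->.
Qed.

(** The set where r > 0 is invariant up to null sets, hence null or of full measure. Either way r
    has a constant sign almost everywhere, and its zero mean forces r = 0. *)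
Lemma ae_invariant_mean0 r : intble mu r -> mean mu r = 0 ->
  (forall i, {ae mu, forall eta, r (tau (- unitZ i) eta) = r eta}) ->
  {ae mu, forall eta, r eta = 0}.
Proof.
move=> Ir r0 rE; have mr := intble_meas Ir.
                                                                                
                 
(* Ergodicity concerns exactly invariant sets, so the set where r > 0 is replaced by the points
   whose whole orbit stays in it. As Z^d is countable, [B] is measurable and almost everywhere the
   same set. *)
pose B := [set eta | forall x, 0 < r (tau x eta)].
have BE : B = \bigcap_n (if unpickle n is Some x
    then [set eta | 0 < r (tau x eta)] else setT).
  apply/seteqP; split => eta /= H => [n _|x].
    by case: unpickle => // x; exact: H.
  by have := H (pickle x) Logic.I; rewrite pickleK.
have mB : measurable B.
  rewrite BE; apply: bigcap_measurable => // n _; case: unpickle => // x.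
  by rewrite -[X in measurable X]setTI; apply: measurable_fun_ltr => //; exact: meas_tau.
have Binv x : tau x @` B = B.
  apply/seteqP; split => eta /=.
    by move=> [y By <-] z; rewrite -(actionD tauE); exact: By.
  by move=> Be; exists (tau (- x) eta); [move=> z; rewrite -(actionD tauE)|rewrite tauKV].
have BP : {ae mu, forall eta, B eta <-> 0 < r eta}.
  have : {ae mu, forall eta, forall n, if unpickle n is Some x
      then r (tau x eta) = r eta else True}.
    apply: ae_foralln => n; case: unpickle => [x|]; last exact: nearW.
    exact: ae_invariant.
  apply: filterS => eta H; split=> [/(_ 0)|re x]; first by rewrite (action0 tauE).
  by have := H (pickle x); rewrite pickleK => ->.
have [B0|B1] := action_ergodic tauE mB Binv.
- have nB : {ae mu, forall eta, ~ B eta}.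
    by exists B; split => // eta /= /contrapT.
  have rN : {ae mu, forall eta, 0 <= -1 * r eta}.
    apply: filterS2 BP nB => eta [_ +] nBe => /contra_not/(_ nBe) /negP.
    by rewrite -leNgt mulN1r oppr_ge0.
  have := mean_ge0_eq0 (intbleZ (-1) Ir) rN.
  rewrite meanZ// r0 mulr0 => /(_ erefl); apply: filterS => eta /eqP.
  by rewrite mulf_eq0 oppr_eq0 oner_eq0 /= => /eqP.
- have yB : {ae mu, forall eta, B eta}.
    exists (~` B); split; [exact: measurableC| |by []].
    by have := probability_setC mu mB; rewrite B1 subee// => ->.
  apply: (mean_ge0_eq0 Ir) r0.
  by apply: filterS2 BP yB => eta [+ _] Be => /(_ Be)/ltW.
Qed.

End action.

                                                

(** * Bounded test functions, gradients and curls, and their density in L^2 *)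

Section bounded_functions.
Context (disp : measure_display) (T : measurableType disp) (R : realType).
Context (mu : probability T R).
Implicit Types f g : T -> R.

Definition bdd f := meas f /\ exists M, forall x, `|f x| <= M.

Lemma bdd_sqint f : bdd f -> sqint mu f.
Proof. by move=> [mf [M fM]]; exact: sqint_bounded fM. Qed.

Lemma bdd_intble f : bdd f -> intble mu f.
Proof. by move=> /bdd_sqint/sqint_intble. Qed.

Lemma bdd_cst (a : R) : bdd (fun=> a).
Proof. by split; [exact: measurable_cst|exists `|a|]. Qed.

Lemma bdd_axpy a f g : bdd f -> bdd g -> bdd (fun x => a * f x + g x).
Proof.
move=> [mf [M fM]] [mg [N gN]]; split; first exact: meas_axpy.
exists (`|a| * M + N) => x; apply: (le_trans (ler_normD _ _)); apply: lerD => //.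
by rewrite normrM ler_wpM2l.
Qed.

Lemma bddD f g : bdd f -> bdd g -> bdd (fun x => f x + g x).
Proof. by move=> /(bdd_axpy 1) H /H; under eq_fun do rewrite mul1r. Qed.

Lemma bddZ a f : bdd f -> bdd (fun x => a * f x).
Proof. by move=> /(bdd_axpy a)/(_ (bdd_cst 0)); under eq_fun do rewrite addr0. Qed.

Lemma bddB f g : bdd f -> bdd g -> bdd (fun x => f x - g x).
Proof.
by move=> Hf /(bdd_axpy (-1))/(_ Hf); under eq_fun do rewrite mulN1r addrC.
Qed.

Lemma bddM f g : bdd f -> bdd g -> bdd (fun x => f x * g x).
Proof.
move=> [mf [M fM]] [mg [N gN]]; split; first exact: measurable_funM.
by exists (M * N) => x; rewrite normrM ler_pM.
Qed.

Lemma bdd_sum I (s : seq I) (F : I -> T -> R) :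
  (forall i, bdd (F i)) -> bdd (fun x => \sum_(i <- s) F i x).
Proof.
move=> IF; elim: s => [|i s IH].
  by under eq_fun do rewrite big_nil; exact: bdd_cst.
by under eq_fun do rewrite big_cons; exact: bddD.
Qed.

Lemma bdd_clip f : meas f -> bdd (fun x => clip 1 (f x)).
Proof.
by move=> mf; split; [exact: meas_clip|exists 1 => x; exact: clip_bounded].
Qed.

Lemma mul_clip_ge0 (t : R) : 0 <= t * clip 1 t.
Proof.
rewrite /clip; case: (lerP 1 t) => H; case: (lerP (- 1) _) => H2;
  by rewrite -?expr2 ?sqr_ge0//; nra.
Qed.

Lemma mul_clip_eq0 (t : R) : t * clip 1 t = 0 -> t = 0.
Proof.
rewrite /clip; case: (lerP 1 t) => H; case: (lerP (- 1) _) => H2 /eqP;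
  by rewrite mulf_eq0 => /orP[]/eqP; lra.
Qed.

(** [clip 1 f] is a bounded function with the sign of f that vanishes only where f does.
    Orthogonality to bounded functions can thus be tested with it. *)
Lemma mean_mul_clip_eq0 f : sqint mu f -> mean mu (fun x => f x * clip 1 (f x)) = 0 ->
  {ae mu, forall x, f x = 0}.
Proof.
move=> Sf /mean_ge0_eq0 H.
have : {ae mu, forall x, f x * clip 1 (f x) = 0}.
  apply: H; last by apply: nearW => x; exact: mul_clip_ge0.
  by apply: sqint_mul => //; apply/bdd_sqint/bdd_clip; exact: Sf.1.
by apply: filterS => x; exact: mul_clip_eq0.
Qed.

(** Integrate |f g| <= f^2 / e + e g^2. *)
Lemma mean_mul_le f g (e : R) : 0 < e -> sqint mu f -> sqint mu g ->
  mean mu (fun x => f x ^+ 2) <= e ^+ 2 ->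
  `|mean mu (fun x => f x * g x)| <= e * (1 + mean mu (fun x => g x ^+ 2)).
Proof.
move=> e0 Sf Sg fe; apply: (le_trans (mean_norm (sqint_mul Sf Sg))).
apply: (@le_trans _ _ (mean mu (fun x => e^-1 * f x ^+ 2 + e * g x ^+ 2))).
  apply: le_mean.
  - by apply: intble_norm; exact: sqint_mul.
  - by apply: intble_axpy; [exact: Sf.2|apply: intbleZ; exact: Sg.2].
  move=> x; rewrite -(ler_pM2l e0) mulrDr mulrA divff ?gt_eqF// mul1r normrM.
  rewrite -[f x ^+ 2]real_normK ?num_real// -[g x ^+ 2]real_normK ?num_real//.
  have := normr_ge0 (f x); have := normr_ge0 (g x).
  have := sqr_ge0 (`|f x| - e * `|g x|); rewrite !expr2; nra.
rewrite mean_axpy; [|exact: Sf.2|apply: intbleZ; exact: Sg.2].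
rewrite meanZ; last exact: Sg.2.
rewrite mulrDr mulr1 lerD2r -(ler_pM2l e0) mulrA divff ?gt_eqF// mul1r.
by rewrite -expr2.
Qed.

End bounded_functions.

Section decompositions.
Context (disp : measure_display) (T : measurableType disp) (R : realType).
Context (mu : probability T R) (d : nat) (tau : 'rV[int]_d -> T -> T).
Hypothesis tauE : ergodic_action mu tau.
Implicit Types f g : T -> R.

(** The L^2(mu) adjoint of [gradD], because the action preserves mu. *)
Definition gradDstar (f : T -> R) (i : 'I_d) (eta : T) : R :=
  f (tau (unitZ i) eta) - f eta.

(** The divergence, in adjoint differences, of the antisymmetric matrix S_ij - S_ji.
    Antisymmetrizing here leaves the potential S free. *)
Definition curl (S : 'I_d -> 'I_d -> T -> R) (j : 'I_d) (eta : T) : R :=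
  \sum_i gradDstar (fun t => S i j t - S j i t) i eta.

Lemma bdd_tau x f : bdd f -> bdd (fun eta => f (tau x eta)).
Proof.
by move=> [mf [M fM]]; split; [exact: (meas_tau tauE)|exists M].
Qed.

Lemma bdd_gradD f i : bdd f -> bdd (gradD tau f i).
Proof. by move=> Hf; apply: bddB => //; exact: bdd_tau. Qed.

Lemma bdd_gradDstar f i : bdd f -> bdd (gradDstar f i).
Proof. by move=> Hf; apply: bddB => //; exact: bdd_tau. Qed.

Lemma bdd_curl S j : (forall i j, bdd (S i j)) -> bdd (curl S j).
Proof. by move=> HS; apply: bdd_sum => i; apply: bdd_gradDstar; exact: bddB. Qed.

Lemma sqint_gradD f i : sqint mu f -> sqint mu (gradD tau f i).
Proof. by move=> Hf; apply: sqintB => //; exact: (sqint_tau tauE). Qed.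

Lemma sqint_gradDstar f i : sqint mu f -> sqint mu (gradDstar f i).
Proof. by move=> Hf; apply: sqintB => //; exact: (sqint_tau tauE). Qed.

Lemma mean_gradD_adjoint f g i : sqint mu f -> sqint mu g ->
  mean mu (fun eta => gradD tau f i eta * g eta) =
  mean mu (fun eta => f eta * gradDstar g i eta).
Proof.
move=> Sf Sg.
have Sft := sqint_tau tauE (- unitZ i) Sf.
have Sgt := sqint_tau tauE (unitZ i) Sg.
transitivity (mean mu (fun eta => f (tau (- unitZ i) eta) * g eta) -
              mean mu (fun eta => f eta * g eta)).
  rewrite -meanB; try exact: sqint_mul.
  by congr mean; apply/funext => eta; rewrite /gradD mulrBl.
rewrite -(mean_tau tauE (unitZ i)); last exact: sqint_mul.
under [in X in X - _]eq_fun do rewrite (tauK tauE).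
rewrite -meanB; try exact: sqint_mul.
by congr mean; apply/funext => eta; rewrite /gradDstar mulrBr.
Qed.

(** [curl] is the adjoint of k -> D_i k_j - D_j k_i: move the differences onto k and exchange the
    two indices in half of the terms. *)
Lemma mean_mul_curl (k : 'I_d -> T -> R) S :
  (forall i, sqint mu (k i)) -> (forall i j, sqint mu (S i j)) ->
  \sum_j mean mu (fun eta => k j eta * curl S j eta) =
  \sum_i \sum_j mean mu (fun eta =>
    (gradD tau (k j) i eta - gradD tau (k i) j eta) * S i j eta).
Proof.
move=> Sk SS.
transitivity (\sum_j \sum_i (mean mu (fun eta => gradD tau (k j) i eta * S i j eta)
   - mean mu (fun eta => gradD tau (k j) i eta * S j i eta))).
  apply: eq_bigr => j _.
  rewrite (_ : (fun eta => _) = (fun eta => \sum_i (k j eta * gradDstar (S i j) i eta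
      - k j eta * gradDstar (S j i) i eta))); last first.
    apply/funext => eta; rewrite /curl mulr_sumr; apply: eq_bigr => i _.
    by rewrite /gradDstar; ring.
  rewrite mean_sum; last first.
    by move=> i; apply: intbleB; apply: sqint_mul => //; exact: sqint_gradDstar.
  apply: eq_bigr => i _.
  by rewrite !mean_gradD_adjoint// meanB//; apply: sqint_mul => //; exact: sqint_gradDstar.
under eq_bigr do rewrite sumrB.
rewrite sumrB exchange_big/= -sumrB; apply: eq_bigr => i _.
rewrite -sumrB; apply: eq_bigr => j _.
rewrite -meanB; try by apply: sqint_mul => //; exact: sqint_gradD.
by congr mean; apply/funext => eta; ring.
Qed.

Lemma gradD_comm f i j eta :
  gradD tau (gradD tau f i) j eta = gradD tau (gradD tau f j) i eta.
Proof. by rewrite /gradD -!(actionD tauE) [- unitZ j - _]addrC; ring. Qed.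

Lemma gradDstar_gradD f i j eta :
  gradDstar (gradD tau f i) j eta = gradD tau (gradDstar f j) i eta.
Proof. by rewrite /gradDstar /gradD -!(actionD tauE) [unitZ j + _]addrC; ring. Qed.

Lemma ae_invariant_of_star f i :
  {ae mu, forall eta, gradDstar f i eta = 0} ->
  {ae mu, forall eta, f (tau (- unitZ i) eta) = f eta}.
Proof.
move=> /(ae_tau tauE (- unitZ i)); apply: filterS => eta.
by rewrite /gradDstar (tauKV tauE) => /eqP; rewrite subr_eq0 => /eqP.
Qed.

(** Project h onto constants plus sums of D_i g_i with g_i bounded. The residual is orthogonal to
    each D_i g, so its adjoint differences vanish and it is invariant; being orthogonal to constants
    it has mean zero, so it is null. *)
Theorem cohomologous_approx h (e : R) : 0 < e -> sqint mu h ->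
  exists (c : R) (g : 'I_d -> T -> R), (forall i, bdd (g i)) /\
    mean mu (fun eta => (h eta - (c + \sum_i gradD tau (g i) i eta)) ^+ 2) <= e.
Proof.
move=> e0 Sh.
pose W (f : 'I_1 -> T -> R) := exists (c : R) (g : 'I_d -> T -> R), (forall i, bdd (g i)) /\
  f = fun _ eta => c + \sum_i gradD tau (g i) i eta.
have [|||||||k [Sk kW kh]] := @weighted_orthogonal_residual _ T R mu 1 (fun _ _ => 1) 1
  _ _ _ W (fun=> h).
- by move=> _; exact: measurable_cst.
- by [].
- by move=> _ _; rewrite invr1 lexx.
- exists 0, (fun _ _ => 0); split; first by move=> _; exact: bdd_cst.
  apply/funext => i; apply/funext => eta; rewrite add0r big1// => j _.
  by rewrite /gradD subrr.
- move=> f [c [g [Hg ->]]] _; apply/bdd_sqint/bddD; first exact: bdd_cst.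
  by apply: bdd_sum => i; exact: bdd_gradD.
- move=> a _ _ [c [g [Hg ->]]] [c' [g' [Hg' ->]]].
  exists (a * c + c'), (fun i t => a * g i t + g' i t); split.
    by move=> i; exact: bdd_axpy.
  apply/funext => _; apply/funext => eta.
  rewrite mulrDr addrACA mulr_sumr -big_split/=; congr (_ + _).
  by apply: eq_bigr => i _; rewrite /gradD; ring.
- by [].
have k0 : {ae mu, forall eta, k 0 eta = 0}.
  apply: (ae_invariant_mean0 tauE); first exact: sqint_intble.
    have := kW (fun _ _ => 1); rewrite big_ord1.
    under [in mean _ _]eq_fun do rewrite mulr1 mul1r.
    apply; exists 1, (fun _ _ => 0); split; first by move=> _; exact: bdd_cst.
    apply/funext => i; apply/funext => eta.
    by rewrite big1 ?addr0// => j _; rewrite /gradD subrr.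
  move=> i; apply: ae_invariant_of_star; apply: mean_mul_clip_eq0.
    exact: sqint_gradDstar.
  have Sks := sqint_gradDstar i (Sk 0).
  (* Orthogonality to D_i g becomes, by the adjoint relation, the hypothesis of [mean_mul_clip_eq0]
     for [gradDstar (k 0) i]. *)
  pose g := fun eta => clip 1 (gradDstar (k 0) i eta).
  have Hg : bdd g by apply: bdd_clip; exact: Sks.1.
  have := kW (fun _ => gradD tau g i); rewrite big_ord1.
  under [in mean _ _]eq_fun do rewrite mul1r mulrC.
  rewrite mean_gradD_adjoint//; last exact: bdd_sqint.
  under [in mean _ _]eq_fun do rewrite mulrC.
  apply; exists 0, (fun j => if j == i then g else (fun=> 0)); split.
    by move=> j; case: eqP => // _; exact: bdd_cst.
  apply/funext => _; apply/funext => eta.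
  rewrite add0r (bigD1 i)//= eqxx big1 ?addr0// => j /negbTE ->.
  by rewrite /gradD subrr.
have [_ [c [g [Hg ->]]] /(_ 0) He] := kh _ e0.
exists c, g; split => //; apply: le_trans He; rewrite le_eqVlt; apply/orP; left.
have mv : meas (fun eta => h eta - (c + \sum_i gradD tau (g i) i eta)).
  apply: measurable_funB; first exact: Sh.1.
  suff: bdd (fun eta => c + \sum_i gradD tau (g i) i eta) by case.
  by apply: bddD; [exact: bdd_cst|apply: bdd_sum => i; exact: bdd_gradD].
apply/eqP/mean_ae.
- exact: meas_sqr.
- by apply/meas_sqr/measurable_funB => //; exact: (Sk 0).1.
- by apply: filterS k0 => eta ->; rewrite subr0.
Qed.

                                                                               
                                                                  
(** Let k be the residual of p after projection onto constants plus curls. Orthogonality to curls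
    gives D_i k_j = D_j k_i. As p, constants and curls are all orthogonal to gradients, so is k.
    Writing D' for adjoint differences, sum_a <(D_a k_j)^2> = sum_a <(D_j k_a) (D_a k_j)> = sum_a
    <k_a D_a D'_j k_j> = 0. Hence each k_j is invariant, and it has mean zero by orthogonality to
    constants, so k = 0. *)
Theorem curl_approx (p : 'I_d -> T -> R) (e : R) : 0 < e -> (forall i, sqint mu (p i)) ->
  (forall g, sqint mu g -> \sum_i mean mu (fun eta => p i eta * gradD tau g i eta) = 0) ->
  exists (c : 'I_d -> R) (S : 'I_d -> 'I_d -> T -> R),
    (forall i j, bdd (S i j)) /\
    forall j, mean mu (fun eta => (p j eta - (c j + curl S j eta)) ^+ 2) <= e.
Proof.
move=> e0 Sp div_p.
pose W (f : 'I_d -> T -> R) :=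
  exists (c : 'I_d -> R) (S : 'I_d -> 'I_d -> T -> R), (forall i j, bdd (S i j)) /\
  f = fun j eta => c j + curl S j eta.
have WS (f : 'I_d -> T -> R) : W f -> forall i, sqint mu (f i).
  move=> [c [S [HS ->]]] i; apply/bdd_sqint/bddD; first exact: bdd_cst.
  exact: bdd_curl.
have curl0 j eta : curl (fun _ _ _ => 0) j eta = 0.
  by rewrite /curl big1// => i _; rewrite /gradDstar !subrr.
have [|||||||k [Sk kW kh]] := @weighted_orthogonal_residual _ T R mu d (fun _ _ => 1) 1
  _ _ _ W p.
- by move=> _; exact: measurable_cst.
- by [].
- by move=> _ _; rewrite invr1 lexx.
- exists (fun=> 0), (fun _ _ _ => 0); split; first by move=> *; exact: bdd_cst.
  by apply/funext => i; apply/funext => eta; rewrite curl0 addr0.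
- exact: WS.
- move=> a _ _ [c [S [HS ->]]] [c' [S' [HS' ->]]].
  exists (fun j => a * c j + c' j), (fun i j t => a * S i j t + S' i j t); split.
    by move=> i j; exact: bdd_axpy.
  apply/funext => j; apply/funext => eta.
  rewrite mulrDr addrACA /curl mulr_sumr -big_split/=; congr (_ + _).
  by apply: eq_bigr => i _; rewrite /gradDstar; ring.
- by [].
have W_grad v g : W v -> sqint mu g ->
    \sum_j mean mu (fun eta => v j eta * gradD tau g j eta) = 0.
  move=> [c [S [HS ->]]] Sg.
  have SS i j : sqint mu (S i j) by exact: bdd_sqint.
  have SQ j : sqint mu (curl S j) by apply/bdd_sqint/bdd_curl.
  have SG j : sqint mu (gradD tau g j) by exact: sqint_gradD.
  transitivity (\sum_j mean mu (fun eta => gradD tau g j eta * curl S j eta)).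
    apply: eq_bigr => j _.
    rewrite (_ : (fun eta => _) = (fun eta => c j * gradD tau g j eta +
        gradD tau g j eta * curl S j eta)); last first.
      by apply/funext => eta; rewrite mulrDl [_ * curl _ _ _]mulrC.
    rewrite mean_axpy; [|exact: sqint_intble|exact: sqint_mul].
    rewrite /gradD meanB; [|exact/sqint_intble/(sqint_tau tauE)|exact: sqint_intble].
    by rewrite (mean_tau tauE) ?subrr ?mulr0 ?add0r//; exact: sqint_intble.
  rewrite mean_mul_curl// big1// => i _; rewrite big1// => j _.
  rewrite (_ : (fun eta => _) = fun=> 0) ?mean_cst//.
  by apply/funext => eta; rewrite gradD_comm subrr mul0r.
have div_k g : sqint mu g -> \sum_j mean mu (fun eta => k j eta * gradD tau g j eta) = 0.
  move=> Sg; have SG j : sqint mu (gradD tau g j) by exact: sqint_gradD.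
  apply/eqP; rewrite -normr_le0; apply/ler_addgt0Pr => a a0; rewrite add0r.
  pose K := \sum_j (1 + mean mu (fun eta => gradD tau g j eta ^+ 2)).
  have K0 : 0 <= K.
    by apply: sumr_ge0 => j _; rewrite addr_ge0// mean_ge0// => eta; rewrite sqr_ge0.
  (* k is only an L^2 limit of fields p - v that are orthogonal to gradients; accuracy b makes the
     error in the pairing at most a. *)
  pose b := a / (1 + K).
  have b0 : 0 < b by rewrite divr_gt0// ltr_pwDl.
  have [v Wv Hv] := kh _ (exprn_gt0 2 b0).
  have Sv := WS _ Wv.
  have Spv j : sqint mu (fun eta => p j eta - v j eta - k j eta).
    by do 2 apply: sqintB => //.
  have -> : \sum_j mean mu (fun eta => k j eta * gradD tau g j eta) =
      - \sum_j mean mu (fun eta => (p j eta - v j eta - k j eta) * gradD tau g j eta).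
    have E : \sum_j mean mu (fun eta => (p j eta - v j eta - k j eta) * gradD tau g j eta)
      = \sum_j mean mu (fun eta => p j eta * gradD tau g j eta)
      - \sum_j mean mu (fun eta => v j eta * gradD tau g j eta)
      - \sum_j mean mu (fun eta => k j eta * gradD tau g j eta).
      rewrite -!sumrB; apply: eq_bigr => j _.
      rewrite -!meanB; try by [exact: sqint_mul|apply: intbleB; exact: sqint_mul].
      by congr mean; apply/funext => eta; ring.
    by rewrite E div_p// (W_grad v g)// subr0 sub0r opprK.
  rewrite normrN; apply: (@le_trans _ _ (b * K)).
    apply: (le_trans (ler_norm_sum _ _ _)); rewrite mulr_sumr; apply: ler_sum => j _.
    exact: mean_mul_le.
  rewrite /b mulrAC ler_pdivrMr ?ltr_pwDl// ler_wpM2l ?(ltW a0)//; lra.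
have curl_k i j : {ae mu, forall eta, gradD tau (k j) i eta = gradD tau (k i) j eta}.
  pose u i j eta := gradD tau (k j) i eta - gradD tau (k i) j eta.
  have Su a b : sqint mu (u a b) by apply: sqintB; exact: sqint_gradD.
  (* Testing with this potential makes a sum of nonnegative terms vanish, so each term is zero. *)
  pose S a b eta := clip 1 (u a b eta).
  have HS a b : bdd (S a b) by apply: bdd_clip; exact: (Su a b).1.
  have := kW (curl S).
  under eq_bigr do under [in mean _ _]eq_fun do rewrite mul1r.
  rewrite mean_mul_curl//; last by move=> *; exact: bdd_sqint.
  have nonneg a b : 0 <= mean mu (fun eta => u a b eta * S a b eta).
    by apply: mean_ge0 => eta; exact: mul_clip_ge0.
  move=> H.
  have : \sum_a \sum_b mean mu (fun eta => u a b eta * S a b eta) = 0.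
    apply: H; exists (fun=> 0), S; split=> //.
    by apply/funext => a; apply/funext => eta; rewrite add0r.
  move/eqP; rewrite psumr_eq0; last by move=> a _; exact: sumr_ge0.
  move=> /allP /(_ i); rewrite mem_index_enum => /(_ isT) /=.
  rewrite psumr_eq0// => /allP /(_ j); rewrite mem_index_enum => /(_ isT) /= /eqP.
  move=> /(mean_mul_clip_eq0 (Su i j)); apply: filterS => eta /eqP.
  by rewrite subr_eq0 => /eqP.
have k_inv j i : {ae mu, forall eta, gradD tau (k j) i eta = 0}.
  have Skk a b : sqint mu (gradD tau (k a) b) by exact: sqint_gradD.
  apply: mean_sqr_eq0 => //.
  have : \sum_a mean mu (fun eta => gradD tau (k j) a eta ^+ 2) = 0.
    rewrite -[RHS](div_k (gradDstar (k j) j)); last exact: sqint_gradDstar.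
    apply: eq_bigr => a _.
    transitivity (mean mu (fun eta => gradD tau (k a) j eta * gradD tau (k j) a eta)).
      apply: mean_ae; first exact: (meas_sqr (Skk _ _).1).
        by apply: measurable_funM; exact: (Skk _ _).1.
      by apply: filterS (curl_k a j) => eta e1; rewrite expr2 {1}e1.
    rewrite mean_gradD_adjoint//; congr mean; apply/funext => eta.
    by rewrite gradDstar_gradD.
  move/eqP; rewrite psumr_eq0; last first.
    by move=> a _; apply: mean_ge0 => eta; rewrite sqr_ge0.
  by move=> /allP /(_ i); rewrite mem_index_enum => /(_ isT) /= /eqP.
have k0 j : {ae mu, forall eta, k j eta = 0}.
  apply: (ae_invariant_mean0 tauE); first exact: sqint_intble.
    have := kW (fun i _ => (i == j)%:R).
    rewrite (bigD1 j)//= big1 ?addr0; last first.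
      move=> i /negbTE ->.
      by under [in mean _ _]eq_fun do rewrite !mulr0; rewrite mean_cst.
    under [in mean _ _]eq_fun do rewrite eqxx mulr1 mul1r.
    apply; exists (fun i => (i == j)%:R), (fun _ _ _ => 0).
    split; first by move=> *; exact: bdd_cst.
    by apply/funext => i; apply/funext => eta; rewrite curl0 addr0.
  move=> i; apply: filterS (k_inv j i) => eta /eqP.
  by rewrite /gradD subr_eq0 => /eqP.
have [_ [c [S [HS ->]]] He] := kh _ e0.
exists c, S; split => // j; apply: le_trans (He j); rewrite le_eqVlt; apply/orP; left.
have mv : meas (fun eta => p j eta - (c j + curl S j eta)).
  apply: measurable_funB; first exact: (Sp j).1.
  suff: bdd (fun eta => c j + curl S j eta) by case.
  by apply: bddD; [exact: bdd_cst|exact: bdd_curl].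
apply/eqP/mean_ae.
- exact: meas_sqr.
- by apply/meas_sqr/measurable_funB => //; exact: (Sk j).1.
- by apply: filterS (k0 j) => eta ->; rewrite subr0.
Qed.

End decompositions.

                           

(** * A maximal inequality for averages over boxes *)

Section maximal.
Context (disp : measure_display) (T : measurableType disp) (R : realType).
Context (mu : probability T R) (d : nat) (tau : 'rV[int]_d -> T -> T).
Hypothesis tauE : ergodic_action mu tau.
Implicit Types f g h : T -> R.

Lemma bdd_max f g : bdd f -> bdd g -> bdd (fun x => Num.max (f x) (g x)).
Proof.
move=> [mf [M fM]] [mg [N gN]]; split; first exact: measurable_maxr.
exists (M + N) => x; have := fM x; have := gN x; rewrite !ler_norml.
by case: (lerP (f x) (g x)); have := normr_ge0 (f x); have := normr_ge0 (g x);
  have := fM x; have := gN x; move=> *; apply/andP; split; lra.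
Qed.

Lemma bdd_min f g : bdd f -> bdd g -> bdd (fun x => Num.min (f x) (g x)).
Proof.
move=> [mf [M fM]] [mg [N gN]]; split; first exact: measurable_minr.
exists (M + N) => x; have := fM x; have := gN x; rewrite !ler_norml.
by case: (lerP (f x) (g x)); have := normr_ge0 (f x); have := normr_ge0 (g x);
  have := fM x; have := gN x; move=> *; apply/andP; split; lra.
Qed.

Section one_direction.
Variable b : 'rV[int]_d.

Let s f N eta : R := \sum_(k < N) f (tau ((k : nat)%:Z *: b) eta).

Let sS f N eta : s f N.+1 eta = f eta + s f N (tau b eta).
Proof.
rewrite /s big_ord_recl scale0r (action0 tauE); congr (_ + _).
apply: eq_bigr => k _; rewrite -(actionD tauE); congr (f (tau _ _)).
by rewrite lift0 intS scalerDl scale1r addrC.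
Qed.

(** The largest of the partial sums of f along the orbit of b with at most L terms, the empty sum
    included. *)
Fixpoint garsia f L eta : R :=
  if L is L'.+1 then Num.max 0 (f eta + garsia f L' (tau b eta)) else 0.

Lemma garsia_ge0 f L eta : 0 <= garsia f L eta.
Proof. by case: L => [|L] //=; rewrite le_max lexx. Qed.

Lemma garsiaS f L eta : garsia f L eta <= garsia f L.+1 eta.
Proof.
elim: L eta => [|L IH] eta; first by rewrite /= le_max lexx.
rewrite [garsia f L.+1 eta]/= [garsia f L.+2 eta]/= -/garsia.
by rewrite ge_max !le_max lexx /= lerD2l IH orbT.
Qed.

Lemma garsia_partial_sum f L N eta : (N <= L)%N -> s f N eta <= garsia f L eta.
Proof.
elim: L N eta => [|L IH] [|N] eta // NL; try by rewrite /s big_ord0 garsia_ge0.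
by rewrite sS /= le_max lerD2l IH ?orbT.
Qed.

Lemma garsia_shift f L eta : 0 < garsia f L eta ->
  garsia f L eta <= f eta + garsia f L (tau b eta).
Proof.
case: L => [|L]; first by rewrite ltxx.
rewrite [garsia f L.+1 eta]/= lt_max ltxx /= => /ltW H.
by rewrite max_r// lerD2l garsiaS.
Qed.

Lemma bdd_garsia f L : bdd f -> bdd (garsia f L).
Proof.
move=> Hf; elim: L => [|L IH]; first exact: bdd_cst.
apply: bdd_max; first exact: bdd_cst.
by apply: bddD => //; exact: (bdd_tau tauE).
Qed.

                                                                                   
                                                                               
(** Garsia's argument, stated as a majorant rather than a measure estimate so that it can be
    iterated. Let M be the running maximum for g - lam. Then H = g - M + M o tau_b has the mean of
    g, is nonnegative, and is at least lam where M > 0. Where M = 0 the averages are at most lam;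
    elsewhere they are at most K <= (K / lam) H. *)
Lemma maximal_majorant g K lam L : bdd g -> 0 < K -> 0 < lam ->
  (forall eta, 0 <= g eta <= K) ->
  exists G, [/\ bdd G, forall eta, 0 <= G eta <= K,
    mean mu G <= lam + K / lam * mean mu g &
    forall N eta, (N < L)%N ->
      N.+1%:R^-1 * \sum_(k < N.+1) g (tau ((k : nat)%:Z *: b) eta) <= G eta].
Proof.
move=> Hg K0 lam0 gK.
pose f := fun eta => g eta - lam.
have Hf : bdd f by apply: bddB => //; exact: bdd_cst.
pose M := garsia f L.
have HM : bdd M by exact: bdd_garsia.
pose H := fun eta => g eta - M eta + M (tau b eta).
have HH : bdd H by apply: bddD; [exact: bddB|exact: (bdd_tau tauE)].
have H1 eta : 0 < M eta -> lam <= H eta.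
  by move=> /garsia_shift; rewrite /H /f -/M; lra.
have H0 eta : 0 <= H eta.
  have := garsia_ge0 f L eta; rewrite -/M le_eqVlt => /orP[/eqP M0|/H1]; last lra.
  rewrite /H -M0 subr0 addr_ge0 ?garsia_ge0//.
  by case/andP: (gK eta).
(* The cap at K preserves the bound 0 <= G <= K required for the next direction. *)
exists (fun eta => Num.min K (K / lam * H eta + lam)); split.
- by apply: bdd_min; [exact: bdd_cst|apply: bdd_axpy => //; exact: bdd_cst].
- move=> eta; rewrite ge_min lexx /= le_min (ltW K0)/= addr_ge0 ?(ltW lam0)//.
  by rewrite mulr_ge0// divr_ge0// ltW.
- apply: (@le_trans _ _ (mean mu (fun eta => K / lam * H eta + lam))).
    apply: le_mean => [||eta]; last by rewrite ge_min lexx orbT.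
      apply/bdd_intble/bdd_min; first exact: bdd_cst.
      by apply: bdd_axpy => //; exact: bdd_cst.
    by apply/bdd_intble/bdd_axpy => //; exact: bdd_cst.
  rewrite mean_axpy; [|exact: bdd_intble|exact: intble_cst].
  rewrite mean_cst addrC lerD2l /H meanD; last 2 first.
  - by apply/bdd_intble/bddB.
  - by apply/bdd_intble/(bdd_tau tauE).
  rewrite meanB; [|exact: bdd_intble|exact: bdd_intble].
  by rewrite (mean_tau tauE) ?subrK//; exact: bdd_intble.
move=> N eta NL; rewrite le_min; apply/andP; split.
  rewrite ler_pdivrMl ?ltr0n// mulrC mulr_natr.
  apply: (@le_trans _ _ (\sum_(k < N.+1) K)); last by rewrite sumr_const card_ord.
  by apply: ler_sum => k _; case/andP: (gK (tau (k%:Z *: b) eta)).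
have := garsia_ge0 f L eta; rewrite -/M le_eqVlt => /orP[/eqP M0|M0].
  apply: (@le_trans _ _ lam); last first.
    by rewrite lerDr mulr_ge0// divr_ge0// ltW.
  have := @garsia_partial_sum f L N.+1 eta NL; rewrite -/M -M0 /s sumrB.
  rewrite sumr_const card_ord subr_le0 => H2.
  by rewrite ler_pdivrMl ?ltr0n// mulrC mulr_natr.
apply: (@le_trans _ _ K); last first.
  apply: (@le_trans _ _ (K / lam * lam)); first by rewrite divfK// gt_eqF.
  apply: (@le_trans _ _ (K / lam * H eta)); last by rewrite lerDl ltW.
  by rewrite ler_wpM2l ?H1// divr_ge0// ltW.
rewrite ler_pdivrMl ?ltr0n// mulrC mulr_natr.
apply: (@le_trans _ _ (\sum_(k < N.+1) K)); last by rewrite sumr_const card_ord.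
by apply: ler_sum => k _; case/andP: (gK (tau (k%:Z *: b) eta)).
Qed.

End one_direction.

(** The number of directions is independent of d, which allows induction on it. *)
Definition box_mean m (b : 'I_m -> 'rV[int]_d) N h eta : R :=
  N.+1%:R ^- m * \sum_(x : 'rV['I_N.+1]_m)
    h (tau (\sum_i (x 0 i : nat)%:Z *: b i) eta).

Lemma sum_rowS m N (F : 'rV['I_N.+1]_m.+1 -> R) :
  \sum_x F x = \sum_(k < N.+1) \sum_(y : 'rV['I_N.+1]_m) F (row_mx (const_mx k : 'rV_1) y).
Proof.
rewrite pair_big /=.
rewrite (reindex (fun p : 'I_N.+1 * 'rV['I_N.+1]_m => row_mx (const_mx p.1 : 'rV_1) p.2))//=.
exists (fun x : 'rV_(1 + m) => (lsubmx x 0 0, rsubmx x)) => [[k y] _|x _] /=.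
  by rewrite row_mxKl row_mxKr mxE.
rewrite -[RHS]hsubmxK; congr row_mx; apply/matrixP => i j.
by rewrite !ord1 mxE.
Qed.

Lemma box_meanS m (b : 'I_m.+1 -> 'rV[int]_d) N h eta :
  box_mean b N h eta = N.+1%:R^-1 * \sum_(k < N.+1)
    box_mean (fun i => b (lift ord0 i)) N h (tau ((k : nat)%:Z *: b ord0) eta).
Proof.
rewrite /box_mean exprS invfM -mulrA sum_rowS.
congr (_ * _); rewrite mulr_sumr; apply: eq_bigr => k _; congr (_ * _).
apply: eq_bigr => y _; rewrite -(actionD tauE) addrC; congr (h (tau _ _)).
rewrite big_ord_recl; congr (_ *: _ + _).
  by rewrite mxE; case: splitP => j //= _; rewrite mxE.
apply: eq_bigr => i _; rewrite mxE; case: splitP => j /=.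
  by rewrite ord1 /bump leq0n.
by rewrite /bump leq0n !add1n => -[] /val_inj ->.
Qed.

(** A box average is an average along the first direction of box averages in the others; these are
    replaced by their majorant, to which [maximal_majorant] then applies. That [del] is independent
    of L permits L to tend to infinity later. *)
Lemma multi_maximal_majorant m (b : 'I_m -> 'rV[int]_d) (K e : R) : 0 < K -> 0 < e ->
  exists2 del, 0 < del & forall g L, bdd g -> (forall eta, 0 <= g eta <= K) ->
    mean mu g <= del ->
    exists G, [/\ bdd G, forall eta, 0 <= G eta <= K, mean mu G <= e &
      forall N eta, (N < L)%N -> box_mean b N g eta <= G eta].
Proof.
move=> K0; elim: m b e => [|m IH] b e e0.
  exists e => // g L Hg gK ge; exists g; split => // N eta _.
  rewrite /box_mean expr0 invr1 mul1r (big_pred1 0) ?big_ord0 ?(action0 tauE)//.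
  by move=> x /=; apply/esym/eqP/matrixP => i [].
(* With lam = e / 2 this makes lam + (K / lam) e' equal to e. *)
pose e' := e ^+ 2 / (4 * K).
have e'0 : 0 < e' by rewrite divr_gt0 ?exprn_gt0// mulr_gt0.
have [del del0 Hdel] := IH (fun i => b (lift ord0 i)) _ e'0.
exists del => // g L Hg gK ge.
have [G [HG GK Ge GN]] := Hdel g L Hg gK ge.
have e2 : 0 < e / 2 by rewrite divr_gt0.
have [G' [HG' GK' Ge' GN']] := maximal_majorant (b ord0) L HG K0 e2 GK.
exists G'; split => //.
  apply: (le_trans Ge'); have Ee : e = e / 2 + K / (e / 2) * e'.
    by rewrite /e'; field; rewrite ?gt_eqF.
  by rewrite [leRHS]Ee lerD2l ler_wpM2l// divr_ge0// ltW.
move=> N eta NL; apply: le_trans (GN' N eta NL).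
rewrite box_meanS ler_wpM2l ?invr_ge0//; apply: ler_sum => k _.
exact: GN.
Qed.

End maximal.

                                      

(** * Box representatives of torus points, and errors at the faces *)

Section torus_boundary.
Context (d n : nat).
Implicit Types x : torus d n.+1.

Lemma torus_repr_addT x i : x 0 i != ord_max ->
  torus_repr (x + unitT n.+1 i) = torus_repr x + unitZ i.
Proof.
move=> xi; have ltn : (x ord0 i < n)%N.
  have := ltn_ord (x 0 i); rewrite ltnS leq_eqVlt => /orP[/eqP e|//].
  by move: xi; rewrite -val_eqE /= e eqxx.
apply/matrixP => j k; rewrite ord1 !mxE /= ?eqxx /= [k == i]eq_sym.
have [<-|ik] /= := eqVneq i k.
  rewrite -PoszD; congr Posz.
  rewrite [(1 %% _)%N]modn_small ?ltnS ?(leq_ltn_trans _ ltn)//.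
  by rewrite modn_small addn1 ?ltnS.
by rewrite mod0n addn0 modn_small// addr0.
Qed.

Lemma torus_repr_subT x i : x 0 i != ord0 ->
  torus_repr (x - unitT n.+1 i) = torus_repr x - unitZ i.
Proof.
move=> xi; rewrite -[x in RHS](subrK (unitT n.+1 i)) torus_repr_addT ?addrK//.
apply: contra xi => /eqP /(congr1 (fun a => a + unitT n.+1 i 0 i)).
rewrite !mxE eqxx subrK => ->; apply/eqP/val_inj => /=.
by rewrite modnDmr addn1 modnn.
Qed.

Lemma card_torus_face i (a : 'I_n.+1) :
  (#|[pred x : torus d n.+1 | x ord0 i == a]| <= n.+1 ^ d.-1)%N.
Proof.
have inj : {in [pred x : torus d n.+1 | x 0 i == a] &, injective (fun x => col' i x)}.
  move=> x y /eqP xa /eqP ya /matrixP e; apply/matrixP => j k; rewrite ord1.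
  case: (unliftP i k) => [k' ->|->]; last by rewrite xa ya.
  by have := e 0 k'; rewrite !mxE.
rewrite -(card_in_image inj); apply: (leq_trans (max_card _)).
by rewrite card_mx mul1n card_ord.
Qed.

(** F and G differ on at most d N^(d-1) of the N^d points, where N = n + 1. The faces to avoid are
    x_i = N-1 for forward shifts and x_i = 0 for backward ones, hence the parameter [a]. *)
Lemma torus_boundary_sum (R : realType) (a : 'I_n.+1) (F G : torus d n.+1 -> R) (C : R) :
  (forall x, (forall i, x 0 i != a) -> F x = G x) ->
  (forall x, `|F x - G x| <= C) ->
  `|n.+1%:R ^- d * (\sum_x F x) - n.+1%:R ^- d * (\sum_x G x)| <= C * d%:R / n.+1%:R.
Proof.
move=> FG FGC; have C0 : 0 <= C by apply: le_trans (FGC 0).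
rewrite -mulrBr -sumrB normrM ger0_norm ?invr_ge0 ?exprn_ge0//.
have H : `|\sum_x (F x - G x)| <= C * d%:R * n.+1%:R ^+ d.-1.
  apply: (le_trans (ler_norm_sum _ _ _)).
  apply: (@le_trans _ _ (\sum_(x : torus d n.+1) \sum_(i < d) C * (x 0 i == a)%:R)).
    apply: ler_sum => x _.
    have [/existsP[i xi]|/existsPn xa] := boolP [exists i, x 0 i == a].
      rewrite (bigD1 i)//= xi mulr1 (le_trans (FGC x))// lerDl sumr_ge0// => j _.
      exact: mulr_ge0.
    by rewrite FG// subrr normr0 sumr_ge0// => j _; exact: mulr_ge0.
  rewrite exchange_big /=.
  apply: (@le_trans _ _ (\sum_(i < d) C * n.+1%:R ^+ d.-1)); last first.
    by rewrite sumr_const card_ord -[leLHS]mulr_natr mulrAC.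
  apply: ler_sum => i _; rewrite -mulr_sumr ler_wpM2l//.
  have -> : \sum_(x : torus d n.+1) (x 0 i == a)%:R =
      #|[pred x : torus d n.+1 | x 0 i == a]|%:R :> R.
    rewrite -sum1_card natr_sum [RHS]big_mkcond /=.
    by apply: eq_bigr => x _; rewrite inE; case: eqP.
  by rewrite -natrX ler_nat card_torus_face.
rewrite ler_pdivrMl ?exprn_gt0//; apply: (le_trans H).
(* [d.-1] is a true predecessor only for d > 0; at d = 0 the factor d makes both sides vanish. *)
case: {F G FG FGC H} d => [|d']; first by rewrite mulr0 !mul0r mulr0.
rewrite exprS; have := @lt0r_neq0 R _ (ltr0Sn R n); move: (n.+1%:R) => N N0 /=.
by rewrite le_eqVlt; apply/orP; left; apply/eqP; field.
Qed.

End torus_boundary.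

                                              

(** * The pointwise ergodic theorem for box averages *)

Section ergodic_theorem.
Context (disp : measure_display) (T : measurableType disp) (R : realType).
Context (mu : probability T R) (d : nat) (tau : 'rV[int]_d -> T -> T).
Hypothesis tauE : ergodic_action mu tau.
Implicit Types (f g h : T -> R) (n : nat).

                                                                                   
Definition torus_mean n h eta : R :=
  n.+1%:R ^- d * \sum_(x : torus d n.+1) h (tau (- torus_repr x) eta).

Lemma torus_mean_box n h eta :
  torus_mean n h eta = box_mean tau (fun i : 'I_d => - unitZ i) n h eta.
Proof.
congr (_ * _); apply: eq_bigr => x _; congr (h (tau _ _)).
rewrite [torus_repr x]row_sum_delta -sumrN; apply: eq_bigr => i _.
by rewrite scalerN mxE.
Qed.

Lemma card_torus n : #|{: torus d n.+1}| = (n.+1 ^ d)%N.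
Proof. by rewrite card_mx card_ord mul1n. Qed.

Lemma torus_mean_cst n (a : R) eta : torus_mean n (fun=> a) eta = a.
Proof.
by rewrite /torus_mean sumr_const card_torus -[X in _ * X]mulr_natr natrX mulrC mulfK.
Qed.

Lemma torus_mean_axpy n a f g eta : torus_mean n (fun t => a * f t + g t) eta =
  a * torus_mean n f eta + torus_mean n g eta.
Proof. by rewrite /torus_mean big_split -mulr_sumr /=; ring. Qed.

Lemma torus_meanB n f g eta : torus_mean n (fun t => f t - g t) eta =
  torus_mean n f eta - torus_mean n g eta.
Proof. by rewrite /torus_mean sumrB mulrBr. Qed.

Lemma le_torus_mean n f g eta : (forall t, f t <= g t) ->
  torus_mean n f eta <= torus_mean n g eta.
Proof.
by move=> fg; rewrite ler_wpM2l ?invr_ge0 ?exprn_ge0// ler_sum.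
Qed.

Lemma torus_mean_norm n f eta :
  `|torus_mean n f eta| <= torus_mean n (fun t => `|f t|) eta.
Proof.
rewrite normrM ger0_norm ?invr_ge0 ?exprn_ge0// ler_wpM2l ?invr_ge0 ?exprn_ge0//.
exact: ler_norm_sum.
Qed.

Lemma torus_mean_bounded n f (M : R) eta : (forall t, `|f t| <= M) ->
  `|torus_mean n f eta| <= M.
Proof.
move=> fM; apply: (le_trans (torus_mean_norm _ _ _)).
by rewrite -[leRHS](torus_mean_cst n M eta) le_torus_mean.
Qed.

Lemma bdd_torus_mean n f : bdd f -> bdd (torus_mean n f).
Proof.
by move=> Hf; apply: bddZ; apply: bdd_sum => x; exact: (bdd_tau tauE).
Qed.

Lemma intble_torus_mean n f : intble mu f -> intble mu (torus_mean n f).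
Proof.
by move=> If; apply: intbleZ; apply: intble_sum => x; exact: (intble_tau tauE).
Qed.

Lemma mean_torus_mean n f : intble mu f -> mean mu (torus_mean n f) = mean mu f.
Proof.
move=> If; rewrite meanZ; last by apply: intble_sum => x; exact: (intble_tau tauE).
rewrite mean_sum; last by move=> x; exact: (intble_tau tauE).
under eq_bigr do rewrite (mean_tau tauE)//.
by rewrite sumr_const card_torus -[X in _ * X]mulr_natr natrX mulrC mulfK.
Qed.

Definition uniformly_small f :=
  exists C, forall n eta, `|torus_mean n f eta| <= C / n.+1%:R.

Lemma uniformly_small_axpy a f g : uniformly_small f -> uniformly_small g ->
  uniformly_small (fun t => a * f t + g t).
Proof.
move=> [C fC] [C' gC]; exists (`|a| * C + C') => n eta; rewrite torus_mean_axpy.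
apply: (le_trans (ler_normD _ _)); rewrite mulrDl lerD// normrM -mulrA.
by rewrite ler_wpM2l.
Qed.

Lemma uniformly_small0 : uniformly_small (fun=> 0).
Proof. by exists 0 => n eta; rewrite torus_mean_cst normr0 mul0r. Qed.

Lemma uniformly_small_sum I (s : seq I) (F : I -> T -> R) :
  (forall i, uniformly_small (F i)) -> uniformly_small (fun t => \sum_(i <- s) F i t).
Proof.
move=> IF; elim: s => [|i s IH].
  by under eq_fun do rewrite big_nil; exact: uniformly_small0.
have := uniformly_small_axpy 1 (IF i) IH; congr uniformly_small.
by apply/funext => t; rewrite big_cons mul1r.
Qed.

(** A torus sum is unchanged by the cyclic shift along e_i, and the cyclic shift agrees with the
    action off one face. *)
Lemma uniformly_small_gradD f i : bdd f -> uniformly_small (gradD tau f i).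
Proof.
move=> [_ [M fM]]; exists ((M + M) * d%:R) => n eta; rewrite /gradD torus_meanB.
pose u (x : torus d n.+1) := f (tau (- torus_repr x) eta).
have -> : torus_mean n f eta = n.+1%:R ^- d * \sum_x u (x + unitT n.+1 i).
  by congr (_ * _); rewrite (reindex_inj (addIr (unitT n.+1 i))).
rewrite {1}/torus_mean; apply: (@torus_boundary_sum d n R ord_max) => [x /(_ i) xi|x].
  by rewrite /u torus_repr_addT// opprD addrC (actionD tauE).
by apply: (le_trans (ler_normB _ _)); apply: lerD; exact: fM.
Qed.

(** The coordinates of a representative are nonnegative, so the shift is a succession of steps -e_i,
    each contributing the gradient of a bounded function. *)
Lemma uniformly_small_shift f n (y : torus d n.+1) : bdd f ->
  uniformly_small (fun t => f (tau (- torus_repr y) t) - f t).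
Proof.
move=> Hf; pose P z := forall g, bdd g -> uniformly_small (fun t => g (tau z t) - g t).
suff : P (- torus_repr y) by apply.
have P0 : P 0.
  move=> g _; have := uniformly_small0; congr uniformly_small.
  by apply/funext => t; rewrite (action0 tauE) subrr.
have PD z z' : P z -> P z' -> P (z + z').
  move=> Pz Pz' g Hg; have Hgz := bdd_tau tauE z Hg.
  have := uniformly_small_axpy 1 (Pz g Hg) (Pz' _ Hgz); congr uniformly_small.
  by apply/funext => t; rewrite (actionD tauE); ring.
apply: row_int_additive_ind => // i; rewrite !mxE scaleNr -scalerN.
elim: (y 0 i : nat) => [|k IH]; first by rewrite scale0r.
by rewrite intS scalerDl scale1r; apply: PD => // g Hg; exact: uniformly_small_gradD.
Qed.

(** f minus its box average is the average over y of f - f o tau_{-y}. *)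
Lemma uniformly_small_sub_torus_mean n f : bdd f ->
  uniformly_small (fun t => f t - torus_mean n f t).
Proof.
move=> Hf.
have := uniformly_small_axpy (- n.+1%:R ^- d) (uniformly_small_sum (index_enum _)
  (fun y : torus d n.+1 => uniformly_small_shift y Hf)) uniformly_small0.
congr uniformly_small; apply/funext => t.
rewrite addr0 sumrB -[X in _ = X - _](torus_mean_cst n (f t) t) /torus_mean.
by ring.
Qed.

(** Write f = c + G + r, with G a sum of gradients and r small in L^2. The averages of G are
    uniformly small, and <f> differs from c by <r>; the three errors are at most e / 4 each. *)
Lemma mean_ergodic f (e : R) : 0 < e -> bdd f ->
  exists n, mean mu (fun t => `|torus_mean n f t - mean mu f|) <= e.
Proof.
move=> e0 Hf; have e4 : 0 < e / 4 by rewrite divr_gt0.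
have [c [g [Hg fg]]] := cohomologous_approx tauE (exprn_gt0 2 e4) (bdd_sqint mu Hf).
pose G t := \sum_i gradD tau (g i) i t.
pose r t := f t - (c + G t).
have HG : bdd G by apply: bdd_sum => i; exact: (bdd_gradD tauE).
have Hr : bdd r by apply: bddB => //; apply: bddD => //; exact: bdd_cst.
have r_le : mean mu (fun t => `|r t|) <= e / 4.
  by apply: mean_norm_le_of_sqr => //; exact: bdd_sqint.
have G0 : mean mu G = 0.
  rewrite mean_sum; last by move=> i; apply/bdd_intble/(bdd_gradD tauE).
  rewrite big1// => i _; rewrite /gradD meanB; [|exact/bdd_intble/(bdd_tau tauE)|exact: bdd_intble].
  by rewrite (mean_tau tauE) ?subrr//; exact: bdd_intble.
have fE : mean mu f = mean mu r + c.
  have -> : mean mu r = mean mu f - (c + mean mu G).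
    rewrite meanB ?meanD ?mean_cst//; try exact: bdd_intble; try exact: intble_cst.
    by apply/bdd_intble/bddD => //; exact: bdd_cst.
  by rewrite G0; ring.
have [C GC] : uniformly_small G.
  by apply: uniformly_small_sum => i; exact: uniformly_small_gradD.
have [n nC] : exists n : nat, C / n.+1%:R <= e / 4.
  exists (Num.truncn (C / (e / 4))).
  by rewrite ler_pdivrMr ?ltr0n// mulrC -ler_pdivrMr// ltW// truncnS_gt.
exists n.
apply: (@le_trans _ _ (mean mu (fun t => torus_mean n (fun t => `|r t|) t + (e / 4 + e / 4)))).
  have Hn : bdd (fun t => `|r t|).
    case: Hr => mr [M rM]; split; first exact: measurableT_comp.
    by exists M => x; rewrite normr_id.
  apply: le_mean.
  - apply/intble_norm/bdd_intble/bddB; last exact: bdd_cst.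
    exact: bdd_torus_mean.
  - by apply/bdd_intble/bddD; [exact: bdd_torus_mean|exact: bdd_cst].
  move=> t.
  have -> : torus_mean n f t - mean mu f =
      torus_mean n r t + (torus_mean n G t - mean mu r).
    have -> : torus_mean n r t = torus_mean n f t - (c + torus_mean n G t).
      rewrite torus_meanB; congr (_ - _).
      have := torus_mean_axpy n 1 (fun=> c) G t.
      by rewrite torus_mean_cst mul1r => <-; congr torus_mean; apply/funext => x; rewrite mul1r.
    by rewrite fE; ring.
  apply: (le_trans (ler_normD _ _)); apply: lerD; first exact: torus_mean_norm.
  apply: (le_trans (ler_normB _ _)); apply: lerD; first exact: le_trans (GC n t) nC.
  by apply: (le_trans (mean_norm (bdd_intble mu Hr))).
have In := intble_norm (bdd_intble mu Hr).
rewrite meanD ?mean_cst ?mean_torus_mean//; [|exact: intble_torus_mean|exact: intble_cst].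
move: r_le; lra.
Qed.

Lemma measure_ge_le_mean g (a : R) : 0 < a -> bdd g -> (forall t, 0 <= g t) ->
  (mu [set t | (a < g t)%R] <= (a^-1 * mean mu g)%:E)%E.
Proof.
move=> a0 Hg g0.
have mg : measurable_fun setT (EFin \o g) by apply/measurable_EFinP; exact: Hg.1.
have := @le_integral_comp_abse _ _ _ mu setT measurableT (EFin \o g) a id
  (@measurable_id _ _ _) (fun _ p => p) (fun _ _ _ _ p => p) mg a0.
have -> : (\int[mu]_t `|(EFin \o g) t| = (mean mu g)%:E)%E.
  rewrite /mean /Rintegral fineK; last exact: (integrable_fin_num measurableT (bdd_intble mu Hg)).
  by apply: eq_integral => t _ /=; rewrite ger0_norm.
move=> H; rewrite EFinM lee_pdivlMl//; apply: le_trans H.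
rewrite setTI; apply: lee_wpmul2l; first by rewrite lee_fin ltW.
apply: le_measure; rewrite ?inE.
- by rewrite -[X in measurable X]setTI; apply: measurable_fun_ltr => //; exact: Hg.1.
- rewrite -[X in measurable X]setTI; apply: emeasurable_fun_c_infty => //.
  exact: measurableT_comp.
- by move=> t /= /ltW ag; rewrite lee_fin ger0_norm.
Qed.

(** Let A_n be the box average and split f into f - A_n f and A_n f. The averages of the first part
    tend to zero uniformly. For the second, [mean_ergodic] makes |A_n f - <f>| small in mean for a
    suitable n, and the maximal inequality then controls all its averages off a set of small
    measure. *)
Lemma ergodic_deviation f (e : R) : 0 < e -> bdd f ->
  {ae mu, forall t, exists n0, forall n, (n0 <= n)%N ->
    `|torus_mean n f t - mean mu f| <= e}.
Proof.
move=> e0 Hf; have e2 : 0 < e / 2 by rewrite divr_gt0.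
have [mf [M fM]] := Hf.
pose K := M + `|mean mu f| + 1.
have M0 : 0 <= M by apply: le_trans (fM point).
have K0 : 0 < K by rewrite ltr_wpDl// addr_ge0.
pose r n t := `|torus_mean n f t - mean mu f|.
have Hr n : bdd (r n).
  have [m1 [N HN]] : bdd (fun t => torus_mean n f t - mean mu f).
    by apply: bddB; [exact: bdd_torus_mean|exact: bdd_cst].
  by split; [exact: measurableT_comp|exists N => t; rewrite normr_id].
have rK n t : 0 <= r n t <= K.
  rewrite /r normr_ge0 /=; apply: (le_trans (ler_normB _ _)).
  by rewrite /K (le_trans (lerD (torus_mean_bounded n t fM) (lexx _))) ?lerDl.
pose E n L := [set t | exists2 N : nat, (N < L)%N & (e / 2 < torus_mean N (r n) t)%R].
have mE n L : measurable (E n L).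
  have -> : E n L = \bigcup_(N in [set N | (N < L)%N]) [set t | (e / 2 < torus_mean N (r n) t)%R].
    by apply/seteqP; split => t /= [N ? ?]; exists N.
  apply: bigcup_measurable => N _; rewrite -[X in measurable X]setTI.
  by apply: measurable_fun_ltr => //; exact: (bdd_torus_mean N (Hr n)).1.
have small (eps : R) : 0 < eps -> exists n, forall L, (mu (E n L) <= eps%:E)%E.
  move=> eps0.
  (* A majorant of mean at most (e / 2) eps exceeds e / 2 on a set of measure at most eps. *)
  have [del del0 H] := multi_maximal_majorant tauE (fun i : 'I_d => - unitZ i) K0
    (mulr_gt0 e2 eps0).
  have [n nd] := mean_ergodic del0 Hf.
  exists n => L; have [G [HG GK Ge GN]] := H (r n) L (Hr n) (rK n) nd.
  have G0 t : 0 <= G t by case/andP: (GK t).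
  apply: (@le_trans _ _ (mu [set t | (e / 2 < G t)%R])).
    apply: le_measure; rewrite ?inE//.
      by rewrite -[X in measurable X]setTI; apply: measurable_fun_ltr => //; exact: HG.1.
    move=> t [N NL] /= /lt_le_trans; apply; rewrite torus_mean_box; exact: GN.
  apply: (le_trans (measure_ge_le_mean e2 HG G0)).
  by rewrite lee_fin ler_pdivrMl.
(* Outside [F n] the bound holds for every N. As [F n] can be made arbitrarily small in measure,
   almost every point lies outside some [F n]. *)
pose F n := \bigcup_L E n L.
have mF n : measurable (F n) by exact: bigcup_measurable.
have smallF (eps : R) : 0 < eps -> exists n, (mu (F n) <= eps%:E)%E.
  move=> /small[n nL]; exists n.
  have := @nondecreasing_cvg_mu _ _ _ mu (E n) (mE n) (mF n).
  have nd : nondecreasing_seq (E n).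
    move=> L L' LL'; apply/subsetPset => t [N NL Nt]; exists N => //.
    exact: leq_trans NL LL'.
  move=> /(_ nd) cv; rewrite -(cvg_lim _ cv)//.
  apply: lime_le; first by apply/cvg_ex; eexists; exact: cv.
  by apply: nearW => L; exact: nL.
have : mu.-negligible (\bigcap_n F n).
  apply/negligibleP; first by apply: bigcapT_measurable.
  apply/eqP; rewrite eq_le measure_ge0 andbT; apply/lee_addgt0Pr => eps eps0.
  rewrite add0e; have [n] := smallF _ eps0; apply: le_trans.
  apply: le_measure; rewrite ?inE//; first exact: bigcapT_measurable.
  exact: bigcap_inf.
apply: negligibleS => t /= nt n _; apply: contrapT => nF; apply: nt.
have [C HC] := uniformly_small_sub_torus_mean n Hf.
exists (Num.truncn (C / (e / 2))) => N nN.
have : torus_mean N (r n) t <= e / 2.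
  rewrite leNgt; apply/negP => lt; apply: nF; exists N.+1 => //.
  by exists N.
have CN : C / N.+1%:R <= e / 2.
  rewrite ler_pdivrMr ?ltr0n// mulrC -ler_pdivrMr// ltW//.
  by rewrite (lt_le_trans (truncnS_gt _))// ler_nat ltnS.
have -> : torus_mean N f t - mean mu f =
    torus_mean N (fun x => f x - torus_mean n f x) t +
    torus_mean N (fun x => torus_mean n f x - mean mu f) t.
  by rewrite !torus_meanB torus_mean_cst; ring.
move=> H; rewrite (splitr e); apply: (le_trans (ler_normD _ _)); apply: lerD.
  exact: le_trans (HC N t) CN.
exact: le_trans (torus_mean_norm _ _ _) H.
Qed.

Theorem ergodic_theorem f : bdd f ->
  {ae mu, forall t, (fun n => torus_mean n f t) @ \oo --> mean mu f}.
Proof.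
move=> Hf; have : {ae mu, forall t, forall k : nat, exists n0, forall n, (n0 <= n)%N ->
    `|torus_mean n f t - mean mu f| <= k.+1%:R^-1}.
  by apply: ae_foralln => k; apply: ergodic_deviation; rewrite ?invr_gt0.
apply: filterS => t H; apply/cvgrPdist_le => e e0.
have [n0 Hn] := H (Num.truncn e^-1).
exists n0 => // n /= /Hn; rewrite distrC => /le_trans; apply.
by rewrite -[leRHS]invrK lef_pV2 ?posrE ?invr_gt0// ltW// truncnS_gt.
Qed.

End ergodic_theorem.

                                                         

(** * Fields orthogonal to gradients on the torus; the two energies as quadratic forms *)

Section torus_fields.
Context (R : realType) (d n : nat).
Implicit Types (u : torus d n.+1 -> R).
Local Notation e_ := (@unitT d n.+1).

Lemma torus_sum_shift u i : \sum_x u (x + e_ i) = \sum_x u x.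
Proof. by rewrite [RHS](reindex_inj (addIr (e_ i))). Qed.

Lemma torus_summation_by_parts u (s : torus d n.+1 -> R) i :
  \sum_x (s (x - e_ i) - s x) * u x = \sum_x s x * (u (x + e_ i) - u x).
Proof.
under eq_bigr do rewrite mulrBl; under [RHS]eq_bigr do rewrite mulrBr.
rewrite !sumrB; congr (_ - _).
rewrite -(torus_sum_shift _ i); apply: eq_bigr => x _; by rewrite addrK.
Qed.

                                                                                 
                          
(** Increments of u sum to zero on the torus, which removes the constants. Summation by parts pairs
    s_ij with the second difference of u in directions i and j, which is symmetric, whereas s is
    antisymmetric. *)
Lemma torus_flux_orthogonal (c : 'I_d -> R) (s : 'I_d -> 'I_d -> torus d n.+1 -> R) u :
  (forall i j x, s i j x = - s j i x) ->
  \sum_x \sum_j (c j + \sum_i (s i j (x - e_ i) - s i j x)) * (u (x + e_ j) - u x) = 0.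
Proof.
move=> anti.
rewrite exchange_big /=.
pose A i j := \sum_x s i j x * (u (x + e_ i + e_ j) - u (x + e_ i) - (u (x + e_ j) - u x)).
transitivity (\sum_j \sum_i A i j).
  apply: eq_bigr => j _.
  under eq_bigr do rewrite mulrDl mulr_suml.
  rewrite big_split /= -mulr_sumr sumrB torus_sum_shift subrr mulr0 add0r.
  rewrite exchange_big /=; apply: eq_bigr => i _.
  exact: (torus_summation_by_parts (fun x => u (x + e_ j) - u x) (s i j) i).
have AN i j : A j i = - A i j.
  rewrite -sumrN; apply: eq_bigr => x _.
  rewrite anti [x + e_ j + e_ i]addrAC; ring.
have : \sum_j \sum_i A i j = - \sum_j \sum_i A i j.
  rewrite [LHS]exchange_big /= -sumrN; apply: eq_bigr => i _.
  by rewrite -sumrN; apply: eq_bigr => j _; exact: AN.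
lra.
Qed.

End torus_fields.

Section energies.
Context (disp : measure_display) (T : measurableType disp) (R : realType).
Context (mu : probability T R) (d : nat) (tau : 'rV[int]_d -> T -> T).
Hypothesis tauE : ergodic_action mu tau.
Context (xi : 'I_d -> T -> R) (c : R).
Hypothesis xi_meas : forall i, meas (xi i).
Hypothesis c_gt0 : 0 < c.
Hypothesis xi_itv : forall i t, c^-1 <= xi i t <= c.
Implicit Types (l : 'cV[R]_d) (f g : T -> R).

Let xi_gt0 i t : 0 < xi i t.
Proof. by have /andP[+ _] := xi_itv i t; apply: lt_le_trans; rewrite invr_gt0. Qed.

Let xi_norm i t : `|xi i t| <= c.
Proof. exact: (weight_norm c_gt0 xi_itv). Qed.

Definition hom_energy l f : R :=
  \sum_i mean mu (fun t => xi i t * (l i 0 + gradD tau f i t) ^+ 2).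

Definition per_energy n t l (u : torus d n.+1 -> R) : R :=
  n.+1%:R ^- d * \sum_x \sum_i
    xi i (tau (- torus_repr x) t) * (l i 0 + u (x + unitT n.+1 i) - u x) ^+ 2.

Definition hom_value := inf_energy (sqint mu) hom_energy.
Definition per_value n t := inf_energy (fun=> True) (per_energy (n := n) t).

Lemma sqint_lgrad l f i : sqint mu f -> sqint mu (fun t => l i 0 + gradD tau f i t).
Proof. by move=> Sf; apply: sqintD; [exact: sqint_cst|exact: (sqint_gradD tauE)]. Qed.

Lemma hom_energy_intble l f i : sqint mu f ->
  intble mu (fun t => xi i t * (l i 0 + gradD tau f i t) ^+ 2).
Proof.
by move=> Sf; apply: (intble_weight (xi_meas i) (xi_norm i)); exact: (sqint_lgrad l i Sf).2.
Qed.

Lemma hom_energy_ge0 l f : 0 <= hom_energy l f.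
Proof.
by apply: sumr_ge0 => i _; apply: mean_ge0 => t; rewrite mulr_ge0 ?sqr_ge0// ltW.
Qed.

Lemma hom_energy_scale a l f : sqint mu f ->
  hom_energy (a *: l) (fun t => a * f t) = a ^+ 2 * hom_energy l f.
Proof.
move=> Sf; rewrite mulr_sumr; apply: eq_bigr => i _.
rewrite -meanZ; last exact: hom_energy_intble.
by congr mean; apply/funext => t; rewrite mxE /gradD; ring.
Qed.

Lemma hom_energy_parallelogram l m f g : sqint mu f -> sqint mu g ->
  hom_energy (l + m) (fun t => f t + g t) + hom_energy (l - m) (fun t => f t - g t) =
  2 * hom_energy l f + 2 * hom_energy m g.
Proof.
move=> Sf Sg; rewrite !mulr_sumr -!big_split; apply: eq_bigr => i _ /=.
have I1 := hom_energy_intble l i Sf; have I2 := hom_energy_intble m i Sg.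
rewrite -!meanZ// -!meanD//; try exact: intbleZ; try apply: hom_energy_intble.
- by congr mean; apply/funext => t; rewrite !mxE /gradD; ring.
- exact: sqintD.
- exact: sqintB.
Qed.

Lemma hom_value_form : exists S : 'M[R]_d,
  S^T = S /\ forall l : 'cV[R]_d, (l^T *m S *m l) 0 0 = hom_value l.
Proof.
apply: inf_energy_form.
- exact: sqint_cst.
- by move=> a f g; exact: sqint_axpy.
- by move=> l f _; exact: hom_energy_ge0.
- by move=> a l f; exact: hom_energy_scale.
- by move=> l m f g; exact: hom_energy_parallelogram.
Qed.

Lemma per_energy_ge0 n t l (u : torus d n.+1 -> R) : 0 <= per_energy t l u.
Proof.
rewrite mulr_ge0 ?invr_ge0 ?exprn_ge0//.
by do 2 (apply: sumr_ge0 => ? _); rewrite mulr_ge0 ?sqr_ge0// ltW.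
Qed.

Lemma per_value_form n t : exists S : 'M[R]_d,
  S^T = S /\ forall l : 'cV[R]_d, (l^T *m S *m l) 0 0 = per_value n t l.
Proof.
apply: inf_energy_form => //.
- by move=> l f _; exact: per_energy_ge0.
- move=> a l f _; rewrite /per_energy [RHS]mulrCA; congr (_ * _).
  rewrite mulr_sumr; apply: eq_bigr => x _; rewrite mulr_sumr; apply: eq_bigr => i _.
  by rewrite !mxE; ring.
- move=> l m f g _ _; rewrite /per_energy !(mulrCA 2) -!mulrDr; congr (_ * _).
  rewrite mulrDr !mulr_sumr -!big_split; apply: eq_bigr => x _ /=.
  rewrite !mulr_sumr -!big_split; apply: eq_bigr => i _ /=.
  by rewrite !mxE; ring.
Qed.

Lemma hom_formE l : hom_form mu tau xi l = (hom_value l)%:E.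
Proof.
rewrite -ereal_inf_energy; last 2 first.
- exact: sqint_cst.
- by move=> m f _; exact: hom_energy_ge0.
congr ereal_inf.
have E f : sqint mu f -> (\sum_(i < d)
    'E_mu[fun t => (xi i t * (l i 0 + gradD tau f i t) ^+ 2)%R])%E = (hom_energy l f)%:E.
  move=> Sf; rewrite -sumEFin; apply: eq_bigr => i _.
  rewrite unlock /mean /Rintegral fineK//.
  exact: (integrable_fin_num measurableT (hom_energy_intble l i Sf)).
apply/seteqP; split => [_ [f /LfunP2 Sf <-]|_ [f Sf <-]]; exists f => //=.
- by rewrite E.
- exact/LfunP2.
- by rewrite E.
Qed.

Lemma per_formE n t l : per_form tau xi n.+1 t l = (per_value n t l)%:E.
Proof.
rewrite -ereal_inf_energy//; last by move=> m f _; exact: per_energy_ge0.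
congr ereal_inf; apply/seteqP; split => _ [u _ <-]; exists u => //;
  congr EFin; congr (_ * _); apply: eq_bigr => x _; apply: eq_bigr => i _;
  congr (_ * _); rewrite /periodized; congr (xi i (tau (- _) t));
  (* Representatives already have coordinates in {0,...,N-1}, so reduction modulo N fixes them. *)
  apply/matrixP => j k; rewrite !mxE modz_small//= ltz_nat ltn_ord //.
Qed.

End energies.

                               

(** * Upper and lower bounds for the periodic form *)

Section bounds.
Context (disp : measure_display) (T : measurableType disp) (R : realType).
Context (mu : probability T R) (d : nat) (tau : 'rV[int]_d -> T -> T).
Hypothesis tauE : ergodic_action mu tau.
Context (xi : 'I_d -> T -> R) (c : R).
Hypothesis xi_meas : forall i, meas (xi i).
Hypothesis c_gt0 : 0 < c.
Hypothesis xi_itv : forall i t, c^-1 <= xi i t <= c.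
Implicit Types (l : 'cV[R]_d) (f g : T -> R).

Local Notation hom_energy := (hom_energy mu tau xi).
Local Notation hom_value := (hom_value mu tau xi).
Local Notation per_energy := (per_energy tau xi).
Local Notation per_value := (per_value tau xi).

Let xi_gt0 i t : 0 < xi i t.
Proof. by have /andP[+ _] := xi_itv i t; apply: lt_le_trans; rewrite invr_gt0. Qed.

Let xi_norm i t : `|xi i t| <= c.
Proof. exact: (weight_norm c_gt0 xi_itv). Qed.

Let xi_bdd i : bdd (xi i).
Proof. by split => //; exists c. Qed.

Let xiV_bdd i : bdd (fun t => (xi i t)^-1).
Proof.
split.
  apply: (@measurable_comp _ _ _ _ _ _ [set x : R | x != 0] (fun x => x^-1)).
  - by apply: open_measurable; exact: open_neq.
  - by move=> _ [t _ <-]; rewrite /= gt_eqF.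
  - apply: open_continuous_measurable_fun; first exact: open_neq.
    by move=> x; rewrite inE /=; exact: inv_continuous.
  - exact: xi_meas.
exists c => t; rewrite ger0_norm ?invr_ge0 ?(ltW (xi_gt0 i t))//.
rewrite -[leRHS]invrK lef_pV2 ?posrE ?invr_gt0//.
by case/andP: (xi_itv i t).
Qed.

Lemma hom_value_le l f : sqint mu f -> hom_value l <= hom_energy l f.
Proof.
apply: inf_energy_le; first exact: sqint_cst.
by move=> m g _; exact: (hom_energy_ge0 _ _ c_gt0 xi_itv).
Qed.

Lemma per_value_le n t l (u : torus d n.+1 -> R) : per_value n t l <= per_energy t l u.
Proof.
apply: inf_energy_le => // m g _; exact: (per_energy_ge0 tau c_gt0 xi_itv).
Qed.

(** Continuity of the energy in L^2, from (a - b)^2 <= (1 + s) a^2 + (1 + 1/s) b^2. The factor 4 c d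
    arises from the weight bound c, from (x - y)^2 <= 2 x^2 + 2 y^2 with both terms of equal mean,
    and from the d directions. *)
Lemma hom_energy_perturb l f g (s : R) : 0 < s -> sqint mu f -> sqint mu g ->
  hom_energy l g <= (1 + s) * hom_energy l f +
    (1 + s^-1) * (4 * c * d%:R * mean mu (fun t => (f t - g t) ^+ 2)).
Proof.
move=> s0 Sf Sg; pose r t := f t - g t.
have Sr : sqint mu r by exact: sqintB.
have -> : (1 + s^-1) * (4 * c * d%:R * mean mu (fun t => (f t - g t) ^+ 2)) =
    \sum_(i < d) (1 + s^-1) * (4 * c * mean mu (fun t => r t ^+ 2)).
  by rewrite sumr_const card_ord -[RHS]mulr_natr; ring.
rewrite mulr_sumr -big_split; apply: ler_sum => i _ /=.
have Id : intble mu (fun t => r (tau (- unitZ i) t) ^+ 2).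
  exact: (sqint_tau tauE (- unitZ i) Sr).2.
have Ir : intble mu (fun t => r t ^+ 2) by exact: Sr.2.
have Ie := hom_energy_intble tauE xi_meas c_gt0 xi_itv l i Sf.
have Ie' := hom_energy_intble tauE xi_meas c_gt0 xi_itv l i Sg.
have s1 : 0 < s^-1 by rewrite invr_gt0.
apply: (@le_trans _ _ (mean mu (fun t => (1 + s) * (xi i t * (l i 0 + gradD tau f i t) ^+ 2) +
   (1 + s^-1) * (2 * c * (r (tau (- unitZ i) t) ^+ 2 + r t ^+ 2))))).
  apply: le_mean => //.
    by apply: intble_axpy => //; do 2 apply: intbleZ; exact: intbleD.
  move=> t; have xi0 := xi_gt0 i t; have /andP[_ xic] := xi_itv i t.
  have -> : l i 0 + gradD tau g i t = l i 0 + gradD tau f i t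
      - (r (tau (- unitZ i) t) - r t) by rewrite /gradD /r; ring.
  move: (l i 0 + _) (r (tau _ _)) (r t) => a b e.
  have h1 : (a - (b - e)) ^+ 2 <= (1 + s) * a ^+ 2 + (1 + s^-1) * (b - e) ^+ 2.
    rewrite -subr_ge0.
    have -> : (1 + s) * a ^+ 2 + (1 + s^-1) * (b - e) ^+ 2 - (a - (b - e)) ^+ 2 =
      s^-1 * (s * a + (b - e)) ^+ 2 by field; rewrite gt_eqF.
    by rewrite mulr_ge0 ?sqr_ge0// ltW.
  have h2 : (b - e) ^+ 2 <= 2 * (b ^+ 2 + e ^+ 2).
    by have := sqr_ge0 (b + e); rewrite !expr2; lra.
  have h3 : xi i t * (b - e) ^+ 2 <= 2 * c * (b ^+ 2 + e ^+ 2).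
    rewrite [2 * c]mulrC -mulrA ler_pM ?sqr_ge0 ?(ltW xi0)//.
  have h4 : (1 + s^-1) * (xi i t * (b - e) ^+ 2) <=
     (1 + s^-1) * (2 * c * (b ^+ 2 + e ^+ 2)).
    by rewrite ler_wpM2l// addr_ge0// ltW.
  have h5 := ler_wpM2l (ltW xi0) h1.
  apply: (le_trans h5); rewrite [leLHS]mulrDr.
  by rewrite [xi i t * ((1 + s) * _)]mulrCA [xi i t * ((1 + s^-1) * _)]mulrCA lerD2l.
rewrite mean_axpy//; last by do 2 apply: intbleZ; exact: intbleD.
rewrite lerD2l meanZ; last by apply: intbleZ; exact: intbleD.
rewrite meanZ; last exact: intbleD.
rewrite meanD//.
have -> : mean mu (fun t => r (tau (- unitZ i) t) ^+ 2) = mean mu (fun t => r t ^+ 2).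
  exact: (mean_tau tauE (- unitZ i) Ir).
by rewrite le_eqVlt; apply/orP; left; apply/eqP; ring.
Qed.

Lemma hom_energy_bounded_near_optimal l (e : R) : 0 < e ->
  exists2 f, bdd f & hom_energy l f <= hom_value l + e.
Proof.
move=> e0; have e2 : 0 < e / 2 by rewrite divr_gt0.
have e4 : 0 < e / 4 by rewrite divr_gt0.
have [||f Sf fe] := @inf_energy_adherent _ _ _ (sqint mu) hom_energy _ _ l _ e2.
- exact: sqint_cst.
- by move=> m g _; exact: (hom_energy_ge0 _ _ c_gt0 xi_itv).
have A0 := hom_energy_ge0 mu tau c_gt0 xi_itv l f.
(* Near-optimality costs e / 2; this s and the truncation cost e / 4 each. *)
pose s := e / 4 / (1 + hom_energy l f).
have A1 : 0 < 1 + hom_energy l f by rewrite ltr_pwDl.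
have s0 : 0 < s by rewrite divr_gt0.
have sA : s * hom_energy l f <= e / 4.
  by rewrite /s mulrAC ler_pdivrMr// ler_wpM2l ?(ltW e4)// lerDr.
pose K := (1 + s^-1) * (4 * c * d%:R).
have K0 : 0 <= K.
  by rewrite /K mulr_ge0 ?addr_ge0 ?invr_ge0 ?(ltW s0)// !mulr_ge0// ltW.
have [|g [M [mg gM fg]]] := @sqint_bounded_approx _ _ _ mu f (e / 4 / (1 + K)) _ Sf.
  by rewrite divr_gt0// ltr_pwDl.
have Hg : bdd g by split; [|exists M].
exists g => //.
apply: (le_trans (hom_energy_perturb l s0 Sf (bdd_sqint mu Hg))).
have : K * mean mu (fun t => (f t - g t) ^+ 2) <= e / 4.
  apply: (le_trans (ler_wpM2l K0 fg)).
  by rewrite mulrCA ger_pMr// ler_pdivrMr ?mul1r ?lerDr// ltr_pwDl.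
rewrite /K -mulrA; move: fe sA; lra.
Qed.

Lemma tau_repr_addT n (x : torus d n.+1) i t : x 0 i != ord_max ->
  tau (- torus_repr (x + unitT n.+1 i)) t = tau (- unitZ i) (tau (- torus_repr x) t).
Proof. by move=> xi0; rewrite torus_repr_addT// opprD addrC (actionD tauE). Qed.

Lemma tau_repr_subT n (x : torus d n.+1) i t : x 0 i != ord0 ->
  tau (- torus_repr (x - unitT n.+1 i)) t = tau (unitZ i) (tau (- torus_repr x) t).
Proof. by move=> xi0; rewrite torus_repr_subT// opprD opprK addrC (actionD tauE). Qed.

Lemma eventually_le_inv (C e : R) : 0 < e ->
  exists n0, forall n, (n0 <= n)%N -> C / n.+1%:R <= e.
Proof.
move=> e0; exists (Num.truncn (C / e)) => n nn.
rewrite ler_pdivrMr ?ltr0n// mulrC -ler_pdivrMr// ltW//.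
by rewrite (lt_le_trans (truncnS_gt _))// ler_nat ltnS.
Qed.

Lemma per_value_upper l (e : R) : 0 < e ->
  {ae mu, forall t, exists n0, forall n, (n0 <= n)%N ->
    per_value n t l <= hom_value l + e}.
Proof.
move=> e0; have e3 : 0 < e / 3 by rewrite divr_gt0.
have [f Hf fe] := hom_energy_bounded_near_optimal l e3.
pose h t := \sum_i xi i t * (l i 0 + gradD tau f i t) ^+ 2.
have Hg i : bdd (fun t => l i 0 + gradD tau f i t).
  by apply: bddD; [exact: bdd_cst|exact: (bdd_gradD tauE)].
have Hh : bdd h.
  apply: bdd_sum => i; apply: bddM; first exact: xi_bdd.
  have := bddM (Hg i) (Hg i); congr bdd; apply/funext => t; exact: expr2.
have mh : mean mu h = hom_energy l f.
  rewrite /h mean_sum// => i.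
  by apply: (hom_energy_intble tauE xi_meas c_gt0 xi_itv); exact: bdd_sqint.
have [_ [M fM]] := Hf; have [_ [Mh hM]] := Hh.
(* Bounds the torus summand minus [h] at every site, including bonds that wrap around. *)
pose C := \sum_i c * (`|l i 0| + M + M) ^+ 2 + Mh.
apply: filterS (ergodic_theorem tauE Hh) => t /cvgrPdist_le /(_ _ e3)[n1 _ Hn1].
have [n2 Hn2] := eventually_le_inv (C * d%:R) e3.
exists (maxn n1 n2) => n; rewrite geq_max => /andP[/Hn1/= {}Hn1 /Hn2 {}Hn2].
pose v (x : torus d n.+1) := f (tau (- torus_repr x) t).
apply: (le_trans (per_value_le t l v)).
have bs : `|per_energy t l v - torus_mean tau n h t| <= C * d%:R / n.+1%:R.
  apply: (@torus_boundary_sum d n R ord_max) => [x xi_max|x].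
    apply: eq_bigr => i _; congr (_ * _ ^+ 2).
    by rewrite /v tau_repr_addT// /gradD addrA.
  apply: (le_trans (ler_normB _ _)); apply: lerD => //.
  apply: (le_trans (ler_norm_sum _ _ _)); apply: ler_sum => i _.
  rewrite normrM normrX ler_pM ?exprn_ge0// lerXn2r ?nnegrE//.
    by rewrite !addr_ge0// (le_trans _ (fM t)).
  apply: (le_trans (ler_normB _ _)); apply: lerD; last exact: fM.
  by apply: (le_trans (ler_normD _ _)); apply: lerD => //; exact: fM.
move: bs Hn1 Hn2; rewrite mh !ler_norml; move: (_ / n.+1%:R) => z.
move=> /andP[_ b1] /andP[b2 _] b3; move: fe; lra.
Qed.


                                                                    
(** k is the residual of the constant field l after projection onto gradients in L^2(xi mu). The
    bound is expressed through 2 l q - q^2 / xi at q = xi k, the quantity that survives transfer to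
    the torus. *)
Lemma optimal_flux l : exists k : 'I_d -> T -> R, [/\ forall i, sqint mu (k i),
  forall g, sqint mu g -> \sum_i mean mu (fun t => xi i t * (k i t * gradD tau g i t)) = 0 &
  hom_value l <= \sum_i (2 * l i 0 * mean mu (fun t => xi i t * k i t) -
    mean mu (fun t => xi i t * k i t ^+ 2))].
Proof.
pose W (f : 'I_d -> T -> R) := exists2 g, sqint mu g & f = gradD tau g.
have [|||||||k [Sk kW kh]] := @weighted_orthogonal_residual _ T R mu d xi c
  _ _ _ W (fun i _ => l i 0).
- exact: xi_meas.
- exact: c_gt0.
- exact: xi_itv.
- exists (fun=> 0); first exact: sqint_cst.
  by apply/funext => i; apply/funext => t; rewrite /gradD subrr.
- by move=> _ [g Sg ->] i; exact: (sqint_gradD tauE).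
- move=> a _ _ [g Sg ->] [g' Sg' ->]; exists (fun t => a * g t + g' t).
    exact: sqint_axpy.
  by apply/funext => i; apply/funext => t; rewrite /gradD; ring.
- by move=> i; exact: sqint_cst.
have orth g : sqint mu g ->
    \sum_i mean mu (fun t => xi i t * (k i t * gradD tau g i t)) = 0.
  by move=> Sg; apply: kW; exists g.
exists k; split => //.
apply/ler_addgt0Pr => e e0.
pose K := 1 + c * d%:R.
have K0 : 0 < K by rewrite ltr_pwDl// mulr_ge0// ltW.
have [_ [g Sg ->] He] := kh _ (divr_gt0 e0 K0).
pose r i t := l i 0 - gradD tau g i t - k i t.
have Sr i : sqint mu (r i).
  apply: sqintB => //; apply: sqintB; first exact: sqint_cst.
  exact: (sqint_gradD tauE).
have SNg : sqint mu (fun t => -1 * g t) by exact: sqintZ.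
apply: (le_trans (hom_value_le l SNg)).
have wI i a b : sqint mu a -> sqint mu b -> intble mu (fun t => xi i t * (a t * b t)).
  exact: (weighted_intble xi_meas c_gt0 xi_itv).
have Sgr i : sqint mu (gradD tau g i) by exact: (sqint_gradD tauE).
(* Expand the square of l - D g = r + k; the gradient term vanishes by orthogonality and the r^2
   term is small. *)
have -> : hom_energy l (fun t => -1 * g t) =
    \sum_i (2 * l i 0 * mean mu (fun t => xi i t * k i t) -
      mean mu (fun t => xi i t * k i t ^+ 2)) +
    \sum_i mean mu (fun t => xi i t * (r i t * r i t)) -
    2 * \sum_i mean mu (fun t => xi i t * (k i t * gradD tau g i t)).
  rewrite mulr_sumr -big_split -sumrB; apply: eq_bigr => i _ /=.
  have I1 := wI i _ _ (Sk i) (sqint_cst mu 1).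
  have I2 := wI i _ _ (Sk i) (Sk i).
  have I3 := wI i _ _ (Sr i) (Sr i).
  have I4 := wI i _ _ (Sk i) (Sgr i).
  have E1 : (fun t => xi i t * k i t) = (fun t => xi i t * (k i t * 1)).
    by apply/funext => t; rewrite mulr1.
  have E2 : (fun t => xi i t * k i t ^+ 2) = (fun t => xi i t * (k i t * k i t)).
    by apply/funext => t; rewrite expr2.
  rewrite E1 E2 -!meanZ// -meanB//; last exact: intbleZ.
  rewrite -meanD//; last by apply: intbleB => //; exact: intbleZ.
  rewrite -meanB//; last 2 first.
  - by apply: intbleD => //; apply: intbleB => //; exact: intbleZ.
  - exact: intbleZ.
  by congr mean; apply/funext => t; rewrite /r /gradD; ring.
rewrite orth// mulr0 subr0 lerD2l.
apply: (@le_trans _ _ (\sum_(i < d) c * (e / K))).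
  apply: ler_sum => i _; apply: (@le_trans _ _ (mean mu (fun t => c * r i t ^+ 2))).
    apply: le_mean; [exact: wI|by apply: intbleZ; exact: (Sr i).2|] => t.
    by rewrite -expr2 ler_wpM2r ?sqr_ge0//; case/andP: (xi_itv i t).
  rewrite meanZ; last exact: (Sr i).2.
  by rewrite ler_wpM2l ?(ltW c_gt0)//; exact: He.
rewrite sumr_const card_ord -[leLHS]mulr_natr mulrAC mulrA ler_pdivrMr//.
by rewrite mulrC ler_wpM2l ?(ltW e0)// /K lerDr.
Qed.

(** The complementary energy density: each term is the minimum over a of xi (l + a)^2 - 2 q a. *)
Let dual_density l (q : 'I_d -> R) t := \sum_j (2 * l j 0 * q j - (xi j t)^-1 * q j ^+ 2).

(** Add twice the vanishing pairing of q with the increments of u. The difference at each bond is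
    then xi times the square of l + increment - q / xi. *)
Lemma per_energy_dual n t l (u : torus d n.+1 -> R) (q : 'I_d -> torus d n.+1 -> R) :
  \sum_x \sum_j q j x * (u (x + unitT n.+1 j) - u x) = 0 ->
  n.+1%:R ^- d * (\sum_x dual_density l (fun j => q j x) (tau (- torus_repr x) t)) <=
  per_energy t l u.
Proof.
move=> q0; rewrite ler_wpM2l ?invr_ge0 ?exprn_ge0//.
rewrite -[leLHS]addr0 -[X in _ + X](mulr0 2) -[X in _ + 2 * X]q0 mulr_sumr -big_split.
apply: ler_sum => x _; rewrite mulr_sumr -big_split; apply: ler_sum => j _ /=.
have x0 := xi_gt0 j (tau (- torus_repr x) t); rewrite -subr_ge0.
move: (xi j _) x0 (q j x) (l j 0) (u (x + _)) (u x) => w w0 p a b b'.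
have -> : w * (a + b - b') ^+ 2 - (2 * a * p - w^-1 * p ^+ 2 + 2 * (p * (b - b'))) =
  w * (a + b - b' - p / w) ^+ 2 by field; rewrite gt_eqF.
by rewrite mulr_ge0 ?sqr_ge0// ltW.
Qed.

Lemma dual_density_bounded l (q : 'I_d -> R) t (B : R) : (forall j, `|q j| <= B) ->
  `|dual_density l q t| <= \sum_j (2 * `|l j 0| * B + c * B ^+ 2).
Proof.
move=> qB; apply: (le_trans (ler_norm_sum _ _ _)); apply: ler_sum => j _.
have B0 : 0 <= B by exact: le_trans (qB j).
apply: (le_trans (ler_normB _ _)); apply: lerD.
  by rewrite !normrM ger0_norm// ler_wpM2l// mulr_ge0.
rewrite normrM normrX ler_pM ?exprn_ge0//; last by rewrite lerXn2r ?nnegrE.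
rewrite ger0_norm ?invr_ge0 ?(ltW (xi_gt0 j t))//.
rewrite -[leRHS]invrK lef_pV2 ?posrE ?invr_gt0//.
by case/andP: (xi_itv j t).
Qed.

(** The dual functional is at least [hom_value l] at p = xi k. Replacing p by a nearby Q = p - E
    lowers it by the mean of 2 E (l - k) + E^2 / xi, summed over directions. *)
Lemma dual_value_approx l (e : R) : 0 < e ->
  exists (a : 'I_d -> R) (S : 'I_d -> 'I_d -> T -> R), (forall i j, bdd (S i j)) /\
    hom_value l - e <=
      mean mu (fun t => dual_density l (fun j => a j + curl tau S j t) t).
Proof.
move=> e0; have [k [Sk div_k hk]] := optimal_flux l.
pose p i t := xi i t * k i t.
have Sp i : sqint mu (p i) by exact: (sqint_weight (xi_meas i) (xi_norm i)).
have div_p g : sqint mu g -> \sum_i mean mu (fun t => p i t * gradD tau g i t) = 0.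
  move=> Sg; rewrite -[RHS](div_k g Sg); apply: eq_bigr => i _.
  by congr mean; apply/funext => t; rewrite /p mulrA.
have Slk j : sqint mu (fun t => l j 0 - k j t) by apply: sqintB => //; exact: sqint_cst.
pose m j := mean mu (fun t => (l j 0 - k j t) ^+ 2).
have m0 j : 0 <= m j by apply: mean_ge0 => t; exact: sqr_ge0.
pose K := \sum_j (2 * (1 + m j) + c).
have K0 : 0 <= K.
  by apply: sumr_ge0 => j _; rewrite addr_ge0 ?(ltW c_gt0)// mulr_ge0// addr_ge0.
have K1 : 0 < 1 + K by rewrite ltr_pwDl.
(* The cap at 1 allows del^2 <= del in the quadratic error term. *)
pose del := Num.min 1 (e / (1 + K)).
have del0 : 0 < del by rewrite lt_min ltr01 divr_gt0.
have del1 : del <= 1 by rewrite ge_min lexx.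
have delK : del * K <= e.
  apply: (@le_trans _ _ (e / (1 + K) * K)).
    by rewrite ler_wpM2r// ge_min lexx orbT.
  by rewrite mulrAC ler_pdivrMr// ler_wpM2l ?(ltW e0)// lerDr.
have [a [S [HS HQ]]] := curl_approx tauE (exprn_gt0 2 del0) Sp div_p.
exists a, S; split => //.
pose Q j t := a j + curl tau S j t.
have SQ j : sqint mu (Q j).
  by apply/bdd_sqint/bddD; [exact: bdd_cst|exact: (bdd_curl tauE)].
pose E j t := p j t - Q j t.
have SE j : sqint mu (E j) by exact: sqintB.
have vI j f : intble mu f -> intble mu (fun t => (xi j t)^-1 * f t).
  by have [mV [B VB]] := xiV_bdd j; apply: intble_weight mV VB.
have IE2 j : intble mu (fun t => E j t ^+ 2) by exact: (SE j).2.
have split_Q : mean mu (fun t => dual_density l (fun j => Q j t) t) =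
    \sum_i (2 * l i 0 * mean mu (fun t => xi i t * k i t) -
      mean mu (fun t => xi i t * k i t ^+ 2)) -
    \sum_j 2 * mean mu (fun t => E j t * (l j 0 - k j t)) -
    \sum_j mean mu (fun t => (xi j t)^-1 * E j t ^+ 2).
  have IQ j : intble mu (fun t => 2 * l j 0 * Q j t - (xi j t)^-1 * Q j t ^+ 2).
    apply: intbleB; first by apply: intbleZ; exact: sqint_intble.
    by apply: vI; exact: (SQ j).2.
  rewrite mean_sum// -!sumrB; apply: eq_bigr => j _.
  have I1 : intble mu (fun t => xi j t * k j t) by exact: sqint_intble (Sp j).
  have I2 : intble mu (fun t => xi j t * k j t ^+ 2).
    by apply: (intble_weight (xi_meas j) (xi_norm j)); exact: (Sk j).2.
  have I3 : intble mu (fun t => E j t * (l j 0 - k j t)) by exact: sqint_mul.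
  have I4 := vI j _ (IE2 j).
  rewrite -!meanZ// -!meanB//; try exact: intbleZ; try by apply: intbleB => //; exact: intbleZ.
    congr mean; apply/funext => t; rewrite /E /p; field.
    by rewrite gt_eqF.
  by apply: intbleB; [apply: intbleB => //; exact: intbleZ|exact: intbleZ].
rewrite split_Q.
have : \sum_j 2 * mean mu (fun t => E j t * (l j 0 - k j t)) +
    \sum_j mean mu (fun t => (xi j t)^-1 * E j t ^+ 2) <= e.
  apply: le_trans delK; rewrite -big_split mulr_sumr; apply: ler_sum => j _ /=.
  rewrite mulrDr; apply: lerD.
    rewrite mulrCA ler_wpM2l//.
    exact: le_trans (ler_norm _) (mean_mul_le del0 (SE j) (Slk j) (HQ j)).
  apply: (@le_trans _ _ (mean mu (fun t => c * E j t ^+ 2))).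
    apply: le_mean; [exact: vI|exact: intbleZ|] => t.
    rewrite ler_wpM2r ?sqr_ge0//.
    rewrite -[leRHS]invrK lef_pV2 ?posrE ?invr_gt0//.
    by case/andP: (xi_itv j t).
  rewrite meanZ// mulrC ler_wpM2r ?(ltW c_gt0)//; apply: (le_trans (HQ j)).
  by rewrite expr2 ler_piMl// ltW.
move: hk; lra.
Qed.

Lemma per_value_lower l (e : R) : 0 < e ->
  {ae mu, forall t, exists n0, forall n, (n0 <= n)%N ->
    hom_value l - e <= per_value n t l}.
Proof.
move=> e0; have e3 : 0 < e / 3 by rewrite divr_gt0.
have [a [S [HS aS]]] := dual_value_approx l e3.
pose Q j t := a j + curl tau S j t.
have HQ j : bdd (Q j) by apply: bddD; [exact: bdd_cst|exact: (bdd_curl tauE)].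
pose h t := dual_density l (fun j => Q j t) t.
have Hh : bdd h.
  apply: bdd_sum => j; apply: bddB; first exact: bddZ.
  apply: bddM => //.
  have := bddM (HQ j) (HQ j); congr bdd; apply/funext => t; exact: expr2.
have /choice[M SM] : forall p : 'I_d * 'I_d, exists M, forall t, `|S p.1 p.2 t| <= M.
  by move=> p; exact: (HS p.1 p.2).2.
have /choice[MQ QM] : forall j, exists M, forall t, `|Q j t| <= M.
  by move=> j; exact: (HQ j).2.
have M0 p : 0 <= M p by exact: le_trans (SM p point).
have MQ0 j : 0 <= MQ j by exact: le_trans (QM j point).
(* A common bound for the field [Q] on X and its torus counterpart [q]. *)
pose B := \sum_j (MQ j + (`|a j| +
  \sum_i (M (i, j) + M (j, i) + (M (i, j) + M (j, i))))).
have term0 j : 0 <= MQ j + (`|a j| +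
    \sum_i (M (i, j) + M (j, i) + (M (i, j) + M (j, i)))).
  by rewrite !addr_ge0// sumr_ge0// => i _; rewrite !addr_ge0.
have leB j : MQ j + (`|a j| +
    \sum_i (M (i, j) + M (j, i) + (M (i, j) + M (j, i)))) <= B.
  by rewrite [leRHS](bigD1 j)//= lerDl sumr_ge0.
pose D := \sum_j (2 * `|l j 0| * B + c * B ^+ 2).
apply: filterS (ergodic_theorem tauE Hh) => t /cvgrPdist_le /(_ _ e3)[n1 _ Hn1].
have [n2 Hn2] := eventually_le_inv ((D + D) * d%:R) e3.
exists (maxn n1 n2) => n; rewrite geq_max => /andP[/Hn1/= {}Hn1 /Hn2 {}Hn2].
apply: le_inf_energy => // [m g _|u _].
  exact: (per_energy_ge0 tau c_gt0 xi_itv).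
(* Only the potential is copied to the torus; its curl [q] is formed with cyclic shifts, so it is
   exactly orthogonal to gradients and equals [Q] along the orbit off the faces x_i = 0. *)
pose s i j (x : torus d n.+1) :=
  S i j (tau (- torus_repr x) t) - S j i (tau (- torus_repr x) t).
pose q j x := a j + \sum_i (s i j (x - unitT n.+1 i) - s i j x).
have anti i j x : s i j x = - s j i x by rewrite /s opprB.
have q0 := torus_flux_orthogonal a u anti.
apply: le_trans (per_energy_dual t l q0).
have sM i j x : `|s i j x| <= M (i, j) + M (j, i).
  apply: (le_trans (ler_normB _ _)); apply: lerD.
    exact: (SM (i, j)).
  exact: (SM (j, i)).
have qB j x : `|q j x| <= B.
  apply: le_trans (leB j); apply: ler_wpDl => //.
  apply: (le_trans (ler_normD _ _)); rewrite lerD2l.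
  apply: (le_trans (ler_norm_sum _ _ _)); apply: ler_sum => i _.
  by apply: (le_trans (ler_normB _ _)); apply: lerD; exact: sM.
have QB j t' : `|Q j t'| <= B.
  apply: le_trans (leB j); apply: ler_wpDr => //.
  by rewrite addr_ge0// sumr_ge0// => i _; rewrite !addr_ge0.
have bs : `|n.+1%:R ^- d * (\sum_x dual_density l (fun j => q j x) (tau (- torus_repr x) t))
    - torus_mean tau n h t| <= (D + D) * d%:R / n.+1%:R.
  apply: (@torus_boundary_sum d n R ord0) => [x x0|x].
    congr dual_density; apply/funext => j; rewrite /q /Q; congr (_ + _).
    by apply: eq_bigr => i _; rewrite /s !tau_repr_subT// /gradDstar.
  apply: (le_trans (ler_normB _ _)); apply: lerD.
    by apply: dual_density_bounded => j; exact: qB.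
  by apply: dual_density_bounded => j; exact: QB.
move: bs Hn1 Hn2; rewrite !ler_norml; move: (_ / n.+1%:R) => z.
move=> /andP[b1 _] /andP[_ b2] b3; move: aS; rewrite -/(mean mu h); lra.
Qed.

End bounds.

                                    

(** * From quadratic forms to matrices, and the conclusion *)

Lemma matrix_cvg (R : realType) m n (A : nat -> 'M[R]_(m, n)) (B : 'M[R]_(m, n)) :
  (forall i j, (fun N => A N i j) @ \oo --> B i j) -> A @ \oo --> B.
Proof.
move=> AB; apply/cvgrPdist_le => e e0.
have : \forall N \near \oo, forall ij : 'I_m * 'I_n, `|B ij.1 ij.2 - A N ij.1 ij.2| <= e.
  by apply: filter_forall => -[i j]; have /cvgrPdist_le/(_ e e0) := AB i j.
apply: filterS => N H.
rewrite /Num.Def.normr /= mx_normrE (bigmax_le _ (ltW e0))//= => ij _.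
by have := H ij; rewrite !mxE.
Qed.

Lemma symmetric_entry (R : realType) d (M : 'M[R]_d) i j : M^T = M ->
  let q (l : 'cV[R]_d) := (l^T *m M *m l) 0 0 in
  M i j = (q (delta_mx i 0 + delta_mx j 0) - q (delta_mx i 0) - q (delta_mx j 0)) / 2.
Proof.
move=> sM /=.
have E i' j' : ((delta_mx i' 0 : 'cV[R]_d)^T *m M *m (delta_mx j' 0 : 'cV[R]_d)) 0 0 = M i' j'.
  by rewrite trmx_delta -rowE -colE !mxE.
have MD (X Y : 'M[R]_1) : (X + Y) 0 0 = X 0 0 + Y 0 0 by rewrite mxE.
rewrite [(_ + _)^T]linearD /= !mulmxDl !mulmxDr !MD !E.
have -> : M j i = M i j by rewrite -[in LHS]sM mxE.
by field.
Qed.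

Lemma form_matrixP (R : realType) d (Q : 'cV[R]_d -> \bar R) :
  (exists S, is_form_matrix Q S) -> is_form_matrix Q (form_matrix Q).
Proof. exact: (@getPex _ [set S | is_form_matrix Q S]). Qed.

Section clipped_rates.
Context (disp : measure_display) (T : measurableType disp) (R : realType).
Context (mu : probability T R) (d : nat) (tau : 'rV[int]_d -> T -> T).
Hypothesis tauE : ergodic_action mu tau.
Context (xi xi' : 'I_d -> T -> R).
Hypothesis xi_meas : forall i, meas (xi i).
Hypothesis xi'_meas : forall i, meas (xi' i).
Hypothesis xi_ae : {ae mu, forall eta, forall i, xi i eta = xi' i eta}.

Lemma hom_form_ae l : hom_form mu tau xi l = hom_form mu tau xi' l.
Proof.
congr ereal_inf; apply: eq_imagel => f /= Lf; apply: eq_bigr => i _.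
have [mf _] := (LfunP2 mu f).1 Lf.
have mg : meas (fun t => (l i 0 + gradD tau f i t) ^+ 2).
  apply: meas_sqr; apply: measurable_funD => //.
  exact: (measurable_funB (meas_tau tauE _ mf) mf).
rewrite unlock; apply: ae_eq_integral => //.
- by apply/measurable_EFinP; exact: (measurable_funM (xi_meas i) mg).
- by apply/measurable_EFinP; exact: (measurable_funM (xi'_meas i) mg).
- by apply: filterS xi_ae => t E _; rewrite E.
Qed.

(** The periodic forms at eta sample the rates only along its countable orbit, so the exceptional
    set is a countable union of translates of a null set. *)
Lemma per_form_ae : {ae mu, forall eta, forall N,
  per_form tau xi N eta = per_form tau xi' N eta}.
Proof.
have : {ae mu, forall eta, forall n, if unpickle n is Some x
    then forall i, xi i (tau x eta) = xi' i (tau x eta) else True}.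
  apply: ae_foralln => n; case: unpickle => [x|]; last exact: nearW.
  exact: (ae_tau tauE x xi_ae).
apply: filterS => t H N.
have {}H x i : xi i (tau x t) = xi' i (tau x t).
  by have := H (pickle x); rewrite pickleK.
apply/funext => l; congr ereal_inf; apply: eq_imagel => u _.
congr EFin; congr (_ * _); apply: eq_bigr => x _; apply: eq_bigr => i _.
by rewrite /periodized H.
Qed.

End clipped_rates.

Theorem theorem4p6 (R : realType) (disp : measure_display)
    (T : measurableType disp) (mu : probability T R)
    (d : nat) (d_ge1 : (1 <= d)%N)
    (tau : 'rV[int]_d -> T -> T) (tau_ergodic : ergodic_action mu tau)
    (xi : 'I_d -> T -> R) (xi_measurable : forall i, measurable_fun setT (xi i))
    (c : R) (c_ge1 : 1 <= c)
    (xi_bounded : {ae mu, forall eta, forall i, c^-1 <= xi i eta <= c}) :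
  is_form_matrix (hom_form mu tau xi) (hom_matrix mu tau xi) /\
  {ae mu, forall eta,
    (forall N : nat, (1 <= N)%N ->
       is_form_matrix (per_form tau xi N eta) (per_matrix tau xi N eta)) /\
    (fun N : nat => per_matrix tau xi N eta) @ \oo --> hom_matrix mu tau xi}.
Proof.
have c0 : 0 < c by exact: lt_le_trans c_ge1.
have cVc : c^-1 <= c by rewrite (le_trans _ c_ge1)// invf_le1.
                                                                                
(* Clipping turns the almost sure bounds into bounds at every point without affecting either form,
   apart from a null set of eta. *)
pose xi' i t := Num.max c^-1 (Num.min c (xi i t)).
have xi'_meas i : meas (xi' i).
  apply: (@measurable_maxr _ _ _ setT (cst c^-1) (fun t => Num.min c (xi i t))) => //.
  exact: (@measurable_minr _ _ _ setT (cst c) (xi i)).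
have xi'_itv i t : c^-1 <= xi' i t <= c.
  by rewrite /xi' le_max lexx /= ge_max cVc ge_min lexx.
have xi_ae : {ae mu, forall eta, forall i, xi i eta = xi' i eta}.
  apply: filterS xi_bounded => t H i; have /andP[a b] := H i.
  by rewrite /xi' min_r// max_r.
have homE l : hom_form mu tau xi l = (hom_value mu tau xi' l)%:E.
  rewrite (hom_form_ae tau_ergodic xi_measurable xi'_meas xi_ae).
  exact: (hom_formE tau_ergodic xi'_meas c0 xi'_itv).
have homP : is_form_matrix (hom_form mu tau xi) (hom_matrix mu tau xi).
  apply: form_matrixP.
  have [S [sS SE]] := hom_value_form tau_ergodic xi'_meas c0 xi'_itv.
  by exists S; split => // l; rewrite SE homE.
split => //.
have cvg_value (l : 'cV[R]_d) : {ae mu, forall t,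
    (fun n => per_value tau xi' n t l) @ \oo --> hom_value mu tau xi' l}.
  have : {ae mu, forall t, forall k : nat, exists n0, forall n, (n0 <= n)%N ->
      `|hom_value mu tau xi' l - per_value tau xi' n t l| <= k.+1%:R^-1}.
    apply: ae_foralln => k; have k0 : 0 < k.+1%:R^-1 :> R by rewrite invr_gt0.
    have U := per_value_upper tau_ergodic xi'_meas c0 xi'_itv l k0.
    have L := per_value_lower tau_ergodic xi'_meas c0 xi'_itv l k0.
    apply: filterS2 U L => t [n1 H1] [n2 H2].
    exists (maxn n1 n2) => n; rewrite geq_max => /andP[/H1 + /H2].
    move: (k.+1%:R^-1) => e; rewrite ler_norml => ? ?; apply/andP; split; lra.
  apply: filterS => t H; apply/cvgrPdist_le => e e0.
  have [n0 Hn] := H (Num.truncn e^-1).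
  exists n0 => // n /= /Hn /le_trans; apply.
  by rewrite -[leRHS]invrK lef_pV2 ?posrE ?invr_gt0// ltW// truncnS_gt.
(* The null set in [cvg_value] depends on l; finitely many l determine all entries by
   polarization. *)
have cvg_entries : {ae mu, forall t, forall ij : 'I_d * 'I_d,
    [/\ (fun n => per_value tau xi' n t (delta_mx ij.1 0 + delta_mx ij.2 0)) @ \oo -->
          hom_value mu tau xi' (delta_mx ij.1 0 + delta_mx ij.2 0),
        (fun n => per_value tau xi' n t (delta_mx ij.1 0)) @ \oo -->
          hom_value mu tau xi' (delta_mx ij.1 0) &
        (fun n => per_value tau xi' n t (delta_mx ij.2 0)) @ \oo -->
          hom_value mu tau xi' (delta_mx ij.2 0)]}.
  apply: filter_forall => -[i j].
  have H1 := cvg_value (delta_mx i 0 + delta_mx j 0).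
  apply: filterS3 H1 (cvg_value (delta_mx i 0)) (cvg_value (delta_mx j 0)).
  by move=> t c1 c2 c3; exact: And3 c1 c2 c3.
have perE := per_form_ae tau_ergodic xi_ae.
apply: filterS2 perE cvg_entries => t perE cvg_entries.
have perE' n l : per_form tau xi n.+1 t l = (per_value tau xi' n t l)%:E.
  by rewrite perE; exact: (per_formE tau c0 xi'_itv).
have perP n : is_form_matrix (per_form tau xi n.+1 t) (per_matrix tau xi n.+1 t).
  apply: form_matrixP.
  have [S [sS SE]] := per_value_form tau c0 xi'_itv n t.
  by exists S; split => // l; rewrite SE perE'.
split; first by case.
apply: matrix_cvg => i j; have [cij ci cj] := cvg_entries (i, j).
have qE (Q : 'cV[R]_d -> \bar R) (q : 'cV[R]_d -> R) S : is_form_matrix Q S ->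
    (forall l, Q l = (q l)%:E) ->
    S i j = (q (delta_mx i 0 + delta_mx j 0) - q (delta_mx i 0) - q (delta_mx j 0)) / 2.
  move=> [sS SQ] Qq; rewrite (symmetric_entry i j sS) /=.
  have e l : (l^T *m S *m l) 0 0 = q l by have := SQ l; rewrite Qq => -[].
  by rewrite !e.
rewrite (qE _ _ _ homP homE).
(* Dropping N = 0, a junk case, leaves the sides N = n + 1 of the earlier estimates. *)
rewrite -(cvg_shiftS (fun N => per_matrix tau xi N t i j)) /=.
under eq_fun do rewrite (qE _ _ _ (perP _) (perE' _)).
exact: cvgMl (cvgB (cvgB cij ci) cj).
Qed.
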